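(* Let $c>1$, $r>0$, and consider the $(c,r)$-ANN problem in the $d$-dimensional Hamming hypercube $\{0,1\}^d$ with a dataset $S$ of $n$ points. There exists an adversarially robust algorithm solving this problem that answers every possible query $q\in\{0,1\}^d$ correctly with probability at least $1-1/n^2$. Its space requirement is $\widetilde{O}(d\cdot n^{1+\rho+o(1)})$ and its time per query is $\widetilde{O}(d^2\cdot n^{\rho})$, where $\rho=1/c$.
   Context: Distances in $\{0,1\}^d$ are Hamming distances. $B_S(q,r):=\{p\in S:\|p-q\|\le r\}$. The $(c,r)$-ANN problem: for each query $q$, if $B_S(q,r)\neq\emptyset$ output a point of $B_S(q,cr)$; if $B_S(q,cr)=\emptyset$ output $\perp$; otherwise either is acceptable. $\widetilde{O}$ hides polylogarithmic factors. *)

(* Defs.v *)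
From HB Require Import structures.
From mathcomp Require Import all_boot all_order all_algebra.
From mathcomp Require Import boolp reals topology normedtype sequences exp.

Set Implicit Arguments.
Unset Strict Implicit.
Unset Printing Implicit Defensive.

Import Order.TTheory GRing.Theory Num.Theory.

Local Open Scope ring_scope.

(** * The (c, r)-ANN problem in the Hamming cube *)

Definition cube (d : nat) := d.-tuple bool.

Definition hamming (d : nat) (p q : cube d) : nat :=
  #|[pred i : 'I_d | tnth p i != tnth q i]|.

Definition ball_in (R : realType) (n d : nat) (S : n.-tuple (cube d))
    (q : cube d) (r : R) : {set cube d} :=
  [set p in S | (hamming p q)%:R <= r].

(** [None] is the answer "bottom". *)
Definition ann_correct (R : realType) (c r : R) (n d : nat)
    (S : n.-tuple (cube d)) (q : cube d) (a : option (cube d)) : Prop :=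
  [/\ ball_in S q r <> set0 ->
        exists2 p, p \in ball_in S q (c * r) & a = Some p,
      ball_in S q (c * r) = set0 -> a = None
    & a = None \/ exists2 p, p \in ball_in S q (c * r) & a = Some p].

(** * Random access machine with logarithmic cost

   A program works on a register file, a memory (addressed indirectly through
   registers) and a read-only input array, all holding natural numbers.
   Unwritten cells contain 0.  The only source of randomness is [Rand]. *)

Inductive binop := Add | Sub | Mul | Div.

Inductive cmd :=
  | Skip
  | Const of nat & nat          (* Const x k  :  x := k                    *)
  | Bin of binop & nat & nat & nat (* Bin o x y z : x := y o z             *)
  | Read of nat & nat           (* Read x y   :  x := mem[y]               *)
  | Write of nat & nat          (* Write x y  :  mem[x] := y               *)
  | Input of nat & nat          (* Input x y  :  x := inp[y]               *)
  | Rand of nat & nat           (* Rand x y   :  x := uniform in [0, y)    *)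
  | Seq of cmd & cmd
  | If of nat & cmd & cmd       (* If x c1 c2 :  c1 when x <> 0, else c2   *)
  | While of nat & cmd.         (* While x c  :  iterate c while x <> 0    *)

Fixpoint deterministic (p : cmd) : bool :=
  match p with
  | Rand _ _ => false
  | Seq p1 p2 | If _ p1 p2 => deterministic p1 && deterministic p2
  | While _ p1 => deterministic p1
  | _ => true
  end.

(** [ctrl] is the stack of commands still to be executed. *)
Record config := Config {
  ctrl : seq cmd;
  regs : seq nat;
  mem : seq nat;
  inp : seq nat
}.

Definition start (p : cmd) (m i : seq nat) : config := Config [:: p] [::] m i.

Definition halted (s : config) : bool := nilp (ctrl s).

Definition reg (s : config) (x : nat) : nat := nth 0%N (regs s) x.

Definition eval_binop (o : binop) (a b : nat) : nat :=
  match o with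
  | Add => a + b
  | Sub => a - b
  | Mul => a * b
  | Div => a %/ b
  end%N.

(** Number of equally likely outcomes of the next step. *)
Definition choices (s : config) : nat :=
  if ctrl s is Rand _ y :: _ then maxn 1 (reg s y) else 1%N.

(** One step, [v < choices s] being the random outcome. *)
Definition step (v : nat) (s : config) : config :=
  match ctrl s with
  | [::] => s
  | p :: k =>
    let upd x a := Config k (set_nth 0%N (regs s) x a) (mem s) (inp s) in
    let goto k' := Config k' (regs s) (mem s) (inp s) in
    match p with
    | Skip => goto k
    | Const x a => upd x a
    | Bin o x y z => upd x (eval_binop o (reg s y) (reg s z))
    | Read x y => upd x (nth 0%N (mem s) (reg s y))
    | Write x y =>
        Config k (regs s) (set_nth 0%N (mem s) (reg s x) (reg s y)) (inp s)
    | Input x y => upd x (nth 0%N (inp s) (reg s y))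
    | Rand x _ => upd x v
    | Seq p1 p2 => goto [:: p1, p2 & k]
    | If x p1 p2 => goto ((if reg s x != 0%N then p1 else p2) :: k)
    | While x p1 => goto (if reg s x != 0%N then [:: p1, p & k] else k)
    end
  end.

(** Length of the binary representation, with [bitlen 0 = 1]. *)
Definition bitlen (a : nat) : nat := (trunc_log 2 a).+1.

(** Logarithmic cost of the next step: the bits of all operands involved,
   addresses included. *)
Definition step_cost (s : config) : nat :=
  match ctrl s with
  | [::] => 0
  | p :: _ =>
    match p with
    | Skip | Seq _ _ => 1
    | Const _ a => bitlen a
    | Bin _ _ y z => bitlen (reg s y) + bitlen (reg s z)
    | Read _ y => bitlen (reg s y) + bitlen (nth 0 (mem s) (reg s y))
    | Write x y => bitlen (reg s x) + bitlen (reg s y)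
    | Input _ y => bitlen (reg s y) + bitlen (nth 0 (inp s) (reg s y))
    | Rand _ y => bitlen (reg s y)
    | If x _ _ | While x _ => bitlen (reg s x)
    end
  end%N.

(** Bits occupied by the registers and by all memory cells up to the highest
   address ever written. *)
Definition config_space (s : config) : nat :=
  (\sum_(a <- regs s) bitlen a + \sum_(a <- mem s) bitlen a)%N.

(** [exec s t w s']: some execution from [s] halts in [s'] after total time [t]
   and with peak space [w]. *)
Inductive exec : config -> nat -> nat -> config -> Prop :=
  | exec_halt s : halted s -> exec s 0 (config_space s) s
  | exec_step s v t w s' :
      ~~ halted s -> (v < choices s)%N -> exec (step v s) t w s' ->
      exec s (step_cost s + t) (maxn (config_space s) w) s'.

(** Probability that the execution from [s] halts within [fuel] steps in a
   configuration satisfying [E]. *)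
Fixpoint prob (R : realType) (E : config -> Prop) (fuel : nat) (s : config) : R :=
  if halted s then (`[< E s >])%:R
  else if fuel is fuel'.+1 then
    (choices s)%:R^-1 * \sum_(v < choices s) prob R E fuel' (step v s)
  else 0.

(** * Data structures: a preprocessing and a query program

   The preprocessing program starts from the empty memory and leaves its data
   structure in memory.  Each query runs on the memory left by the previous one;
   only the input array is replaced, and the registers are cleared. *)

Definition encode_point (d : nat) (p : cube d) : seq nat := map nat_of_bool p.

(** Hamming distances being integers in [0, d], the real radii [r] and [c * r]
   enter the problem only through their integer parts truncated at [d]. *)
Definition encode_instance (R : realType) (c r : R) (n d : nat)
    (S : n.-tuple (cube d)) : seq nat :=
  [:: n; d; minn (Num.truncn r) d; minn (Num.truncn (c * r)) d]
    ++ flatten [seq encode_point p | p <- S].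

(** Register 0 holds 0 for "bottom", and otherwise 1 plus the address of the
   first of the [d] memory cells holding the output point. *)
Definition answer (d : nat) (s : config) : option (cube d) :=
  if reg s 0 is a.+1 then Some [tuple nth 0%N (mem s) (a + i) != 0%N | i < d]
  else None.

Definition history (d : nat) := seq (cube d * option (cube d)).

(** [session qry m h m']: the queries listed in [h], asked in this order to a data
   structure with initial memory [m], receive the answers listed in [h] and leave
   the memory [m']. *)
Inductive session (d : nat) (qry : cmd) (m : seq nat) :
    history d -> seq nat -> Prop :=
  | session_nil : session qry m [::] m
  | session_rcons h m' q t w s :
      session qry m h m' -> exec (start qry m' (encode_point q)) t w s ->
      session qry m (rcons h (q, answer d s)) (mem s).

(** An adaptive adversary chooses the next query from the queries and answers so
   far. *)
Definition adversary (d : nat) := history d -> cube d.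

Definition played_by (d : nat) (adv : adversary d) (h : history d) : Prop :=
  forall h1 q a h2, h = h1 ++ (q, a) :: h2 -> q = adv h1.

Definition all_correct (R : realType) (c r : R) (n d : nat)
    (S : n.-tuple (cube d)) (h : history d) : Prop :=
  forall q a, (q, a) \in h -> ann_correct c r S q a.

(** Event, on the configuration [s] in which preprocessing halts: every possible
   query is answered correctly, whatever queries were asked before it. *)
Definition answers_every_query (R : realType) (c r : R) (n d : nat)
    (S : n.-tuple (cube d)) (qry : cmd) (s : config) : Prop :=
  forall h m, session qry (mem s) h m -> all_correct c r S h.

(** Event: all answers in the [k]-round game against [adv] are correct. *)
Definition withstands (R : realType) (c r : R) (n d : nat)
    (S : n.-tuple (cube d)) (qry : cmd) (adv : adversary d) (k : nat)
    (s : config) : Prop :=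
  forall h m, session qry (mem s) h m -> played_by adv h -> size h = k ->
    all_correct c r S h.

(** For every outcome of the random choices, preprocessing and all queries use at
   most [space] bits, and every query halts within time [time]. *)
Definition resources_within (R : realType) (c r : R) (n d : nat)
    (S : n.-tuple (cube d)) (pre qry : cmd) (space time : nat) : Prop :=
  forall t w s, exec (start pre [::] (encode_instance c r S)) t w s ->
    (w <= space)%N /\
    forall (h : history d) m (q : cube d), session qry (mem s) h m ->
      exists t' w' s', [/\ exec (start qry m (encode_point q)) t' w' s',
        (t' <= time)%N & (w' <= space)%N].

(** Soft-O in the two parameters [n] and [d]: up to a constant and a power of
   [log (n d)]. *)
Definition soft_O (R : realType) (f : nat -> nat -> nat) (g : nat -> nat -> R) :
    Prop :=
  exists (C : R) (k : nat), forall n d, (0 < n)%N -> (0 < d)%N ->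
    (f n d)%:R <= C * (1 + ln (n * d)%:R) ^+ k * g n d.

(* Main.v *)
Require Import Defs.
From HB Require Import structures.
From mathcomp Require Import all_boot all_order all_algebra zify ring lra.
From mathcomp Require Import boolp classical_sets reals topology normedtype sequences exp.

(** A table hashes [x] to [sum_i a_i x_i mod W], where [a_i] is the truncated
   difference [e_i - A] and [e_i] is uniform in [[0, A + W)]: with probability
   [p = A / (A + W)] the coordinate is ignored, and otherwise [a_i] is uniform
   modulo [W]. Points at distance [t] therefore collide with probability between
   [p ^ t] and [p ^ t + 1 / W]. Take [W = n], [s = floor (c r) + 1], and [A] maximal
   with [p ^ s <= 1 / n], so that [p ^ - r] is [O(n ^ (1 / c))].

   A copy consists of [L], about [p ^ - r], tables, searched with a total budget of
   [8 L] candidates. For a fixed query with a near point, no table of the copy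
   reveals that point with probability at most [1 / 2], and far candidates exhaust the
   budget with probability at most [1 / 4] by Markov's inequality. Hence
   [3 (d + log (n ^ 2))] independent copies all fail with probability at most
   [2 ^ - d / n ^ 2], and a union bound covers all [2 ^ d] queries at once. Since a
   query neither flips coins nor writes to memory, adaptivity is then harmless.

   When [n <= d] a linear scan is affordable, and when [c r >= d] any point is an
   answer; both cases are served by a single table with [W = 1]. *)

Set Implicit Arguments.
Unset Strict Implicit.
Unset Printing Implicit Defensive.

(** * Counting seeds *)

(** One linear form does two jobs: coordinates with zero coefficient are left out, as in bit
    sampling, and uniform coefficients modulo [W] already compress the rest to a bucket address, so
    no second hash is needed. The price is an accidental collision rate of [1 / W], which [W = n]
    brings down to the rate [1 / n] already tolerated for far points.

    The sampling rate is tuned through the integer [A]. Since the maximal [A] is at least [s],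
    rounding it loses only the constant factor [c / (c - 1)], and the exponent of the space bound
    needs no o(1) term.

    A table meets on average at most 2 far points, so [8 L] is four times the mean of a copy. A copy
    fails with probability at most 3/4, and [(3 / 4) ^ 3 <= 1 / 2] explains the 3 in the number of
    copies.

    All randomness is one draw from [[0, E ^ (M L d))], so probabilities are counts of seeds. The
    register with the seed has, up to logarithms, no more bits than the data structure: harmless for
    space, but too long for the steps of a query. Hence registers obey a larger bound in
    preprocessing than in queries. *)

Lemma sum_divn_modn (a b : nat) (F : nat -> nat -> nat) : 0 < a ->
  \sum_(x < a * b) F (x %/ a) (x %% a) = \sum_(i < b) \sum_(j < a) F i j.
Proof.
move=> a0; elim: b => [|b IH]; first by rewrite muln0 !big_ord0.
rewrite big_ord_recr /= -IH mulnS addnC big_split_ord /=; congr (_ + _).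
by apply: eq_bigr => j _; rewrite mulnC divnMDl // modnMDl divn_small // modn_small // addn0.
Qed.

Lemma leq_expl k a b : a <= b -> a ^ k <= b ^ k.
Proof. by case: k => // k; rewrite leq_exp2r. Qed.

(** The digits of a uniform seed are uniform and independent; they stand for the separate random
    draws. *)
Definition digit (B v m : nat) := v %/ B ^ m %% B.

Lemma digit_succ B v m : digit B v m.+1 = digit B (v %/ B) m.
Proof. by rewrite /digit expnS divnMA. Qed.

(** One seed is read at three scales: copies, tables of a copy, coefficients of a table. This is the
    passage from one scale to the next. *)
Lemma digit_digit E d v t i : i < d ->
  digit E (digit (E ^ d) v t) i = digit E v (d * t + i).
Proof.
move=> lid; rewrite /digit -expnM expnD divnMA.
set x := v %/ _.
have -> : E ^ d = E * E ^ (d - i.+1) * E ^ i by rewrite -expnS -expnD; congr (_ ^ _); lia.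
rewrite -modn_divl modn_dvdm //; exact: dvdn_mulr.
Qed.

Lemma sum_digit0 B M (F : nat -> nat -> nat) : 0 < B ->
  \sum_(v < B ^ M.+1) F (v %% B) (v %/ B) = \sum_(b < B) \sum_(v < B ^ M) F b v.
Proof.
move=> B0; rewrite expnS (sum_divn_modn _ (fun x y => F y x)) //.
by rewrite exchange_big.
Qed.

(** Independence of the digits: the mean of a product is the product of the means. *)
Lemma sum_prod_digit B M (f : nat -> nat) : 0 < B ->
  \sum_(v < B ^ M) \prod_(m < M) f (digit B v m) = (\sum_(b < B) f b) ^ M.
Proof.
move=> B0; elim: M => [|M IH].
  by rewrite expn0 big_ord_recl !big_ord0.
rewrite [in RHS]expnS -IH big_distrl /=.
pose F b v := f b * \prod_(m < M) f (digit B v m).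
under [in RHS]eq_bigr do rewrite big_distrr /=.
rewrite -(sum_digit0 _ F) //; apply: eq_bigr => v _.
rewrite big_ord_recl /F /digit /= expn0 divn1; congr (_ * _).
by apply: eq_bigr => m _; rewrite -/(digit B v m.+1) digit_succ.
Qed.

(** Linearity of expectation; the factor [B] on the left avoids dividing by the number of values of
    a digit. *)
Lemma sum_sum_digit B L (f : nat -> nat) : 0 < B ->
  B * (\sum_(v < B ^ L) \sum_(l < L) f (digit B v l)) =
  L * B ^ L * \sum_(b < B) f b.
Proof.
move=> B0; elim: L => [|L IH].
  by rewrite expn0 big_ord_recl !big_ord0 muln0.
pose F b v := f b + \sum_(m < L) f (digit B v m).
have -> : \sum_(v < B ^ L.+1) \sum_(l < L.+1) f (digit B v l) =
          \sum_(v < B ^ L.+1) F (v %% B) (v %/ B).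
  apply: eq_bigr => v _; rewrite big_ord_recl /F /digit /= expn0 divn1.
  by congr (_ + _); apply: eq_bigr => m _; rewrite -/(digit B v m.+1) digit_succ.
rewrite sum_digit0 // /F.
under eq_bigr do rewrite big_split /= sum_nat_const card_ord.
rewrite big_split /= -big_distrr /= sum_nat_const card_ord mulnDr IH expnS.
by move: (B ^ L) (\sum_(b < B) f b) => X Y; lia.
Qed.

Lemma sum_eq_mod_le1 W a b : \sum_(w < W) (a + w == b %[mod W]) <= 1.
Proof.
case: (pickP (fun w : 'I_W => a + w == b %[mod W])) => [w0 /eqP h0|h].
  rewrite (bigD1 w0) //= h0 eqxx big1 // => w wn0.
  apply/eqP; rewrite eqb0; apply: contra wn0; rewrite -h0 eqn_modDl.
  by rewrite !modn_small //.
by rewrite big1 // => w _; rewrite h.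
Qed.

(** * Collision probability of one table *)

Section Collision.
Variables (A W : nat).
Hypothesis (W0 : 0 < W).
Let E := A + W.
Let E0 : 0 < E. Proof. by rewrite /E addn_gt0 W0 orbT. Qed.

Definition inner d (a p : nat -> nat) := \sum_(i < d) p i * a i.

Definition coefs x i := digit E x i - A.

Definition collide d (p q : nat -> bool) x :=
  inner d (coefs x) p == inner d (coefs x) q %[mod W].

(** The offsets [y] and [z] carry the coordinates already processed, which makes induction on [d]
    possible. *)
Definition collisions d (p q : nat -> bool) y z :=
  \sum_(x < E ^ d) (y + inner d (coefs x) p == z + inner d (coefs x) q %[mod W]).

(** Number of seeds whose digit lies below [A] wherever [p] and [q] differ; such seeds cannot
    separate the two points. *)
Definition survive d (p q : nat -> bool) := \prod_(i < d) (if p i == q i then E else A).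

Let shift (p : nat -> bool) i := p i.+1.

Lemma collisions_succ d p q y z :
  collisions d.+1 p q y z =
  \sum_(e < E) collisions d (shift p) (shift q) (y + p 0 * (e - A)) (z + q 0 * (e - A)).
Proof.
rewrite /collisions.
pose F e v := nat_of_bool (y + p 0 * (e - A) + inner d (coefs v) (shift p) ==
   z + q 0 * (e - A) + inner d (coefs v) (shift q) %[mod W]).
rewrite -(sum_digit0 _ F) //; apply: eq_bigr => v _; rewrite /F /inner !big_ord_recl !addnA.
have hd (r : nat -> bool) : \sum_(i < d) r (lift ord0 i) * coefs v (lift ord0 i) =
   \sum_(i < d) shift r i * coefs (v %/ E) i.
  by apply: eq_bigr => i _; rewrite /coefs /= digit_succ.
by rewrite !hd /coefs /digit expn0 divn1.
Qed.

Lemma sum_split_range (F : nat -> nat) :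
  \sum_(e < E) F (e - A) = A * F 0 + \sum_(w < W) F w.
Proof.
rewrite /E big_split_ord /=; congr (_ + _).
  rewrite (eq_bigr (fun=> F 0)) ?sum_nat_const ?card_ord // => i _.
  by congr F; apply/eqP; rewrite subn_eq0 ltnW.
by apply: eq_bigr => w _; rewrite addKn.
Qed.

Lemma survive_succ d p q :
  survive d.+1 p q = (if p 0 == q 0 then E else A) * survive d (shift p) (shift q).
Proof. by rewrite /survive big_ord_recl. Qed.

Lemma sum_collisionsl_le d p q y z :
  \sum_(w < W) collisions d p q (y + w) z <= E ^ d.
Proof.
rewrite /collisions exchange_big /=.
apply: leq_trans (_ : \sum_(x < E ^ d) 1 <= _); last by rewrite sum_nat_const card_ord muln1.
apply: leq_sum => x _.
apply: leq_trans (sum_eq_mod_le1 W (y + inner d (coefs x) p) (z + inner d (coefs x) q)).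
by apply: leq_sum => w _; rewrite addnAC.
Qed.

Lemma collisionsC d p q y z : collisions d p q y z = collisions d q p z y.
Proof. by apply: eq_bigr => x _; rewrite eq_sym. Qed.

(* At a coordinate where [p] and [q] differ, the [A] zero coefficients preserve the
   residue, and the [W] others reach any given residue exactly once. *)
Lemma collisions_le d p q y z :
  W * collisions d p q y z <= W * survive d p q + E ^ d.
Proof.
elim: d p q y z => [|d IH] p q y z.
  rewrite /collisions /survive !expn0 big_ord_recl !big_ord0 addn0.
  by case: eqP => _; rewrite ?muln1 ?muln0 // leq_addr.
rewrite collisions_succ survive_succ.
set p' := shift p; set q' := shift q.
(* [F] is the count as a function of the first coefficient when exactly one of the two points has a
   1 there; the disjunction treats both sides at once. *)
have key F : (forall w, F w = collisions d p' q' (y + w) z) \/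
             (forall w, F w = collisions d p' q' y (z + w)) ->
  W * \sum_(e < E) F (e - A) <= W * (A * survive d p' q') + E ^ d.+1.
  move=> hF; rewrite sum_split_range.
  have h1 : F 0 = collisions d p' q' y z by case: hF => ->; rewrite addn0.
  have h2 : \sum_(w < W) F w <= E ^ d.
    case: hF => hF; first by under eq_bigr do rewrite hF; exact: sum_collisionsl_le.
    by under eq_bigr do rewrite hF collisionsC; exact: sum_collisionsl_le.
  have := IH p' q' y z; rewrite h1 expnS.
  move: (collisions _ _ _ _ _) (survive _ _ _) (\sum_(w < W) _) h2 => c s u hu hc.
  have : W * u <= W * E ^ d by rewrite leq_mul2l hu orbT.
  have : A * (W * c) <= A * (W * s + E ^ d) by rewrite leq_mul2l hc orbT.
  rewrite /E; move: (_ ^ d) => X; lia.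
have [pq|] := eqVneq (p 0) (q 0).
  rewrite big_distrr /=; apply: leq_trans (_ : \sum_(e < E) (W * survive d p' q' + E ^ d) <= _).
    by apply: leq_sum.
  by rewrite sum_nat_const card_ord expnS; nia.
move: key; case: (p 0); case: (q 0) => //= key _.
  apply: (key (fun x => collisions d p' q' (y + 1 * x) (z + 0 * x))).
  by left=> w; rewrite mul1n mul0n addn0.
apply: (key (fun x => collisions d p' q' (y + 0 * x) (z + 1 * x))).
by right=> w; rewrite mul1n mul0n addn0.
Qed.

(** The seeds counted by [survive] give both points the same sum even before reduction modulo [W]. A
    common offset survives the induction, since equal coordinates add the same amount to both
    sides. *)
Lemma survive_le_collisions d p q y : survive d p q <= collisions d p q y y.
Proof.
elim: d p q y => [|d IH] p q y.
  by rewrite /collisions /survive /inner !expn0 big_ord_recl !big_ord0 eqxx.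
rewrite collisions_succ survive_succ.
have [pq|] := eqVneq (p 0) (q 0).
  rewrite pq; apply: leq_trans (_ : \sum_(e < E) survive d (shift p) (shift q) <= _).
    by rewrite sum_nat_const card_ord.
  by apply: leq_sum.
move=> _; rewrite (sum_split_range (fun x => collisions d _ _ (y + p 0 * x) (y + q 0 * x))).
by rewrite !muln0 !addn0 (leq_trans _ (leq_addr _ _)) // leq_mul2l IH orbT.
Qed.

Definition dist d (p q : nat -> bool) := \sum_(i < d) (p i != q i).

(** In fractions, [survive] is [(A / E) ^ t * E ^ d] at distance [t]; it is multiplied out to stay
    in the naturals. *)
Lemma survive_dist d p q : survive d p q * E ^ dist d p q = A ^ dist d p q * E ^ d.
Proof.
rewrite /survive /dist !(big_morph (expn _) (expnD _) (expn0 _)) -big_split /=.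
have -> : E ^ d = \prod_(i < d) E by rewrite prod_nat_const card_ord.
rewrite -big_split /=.
by apply: eq_bigr => i _; case: eqP => _ /=; rewrite ?expn0 ?expn1 // ?muln1 ?mul1n.
Qed.

Lemma sum_collide d p q : \sum_(x < E ^ d) collide d p q x = collisions d p q 0 0.
Proof. by []. Qed.

(** The factor 2 adds two rates [1 / n]: one from [(A / E) ^ s <= 1 / n], one from accidental
    collisions modulo [W >= n]. *)
Lemma far_collisions n s d p q : 0 < n -> n * A ^ s <= E ^ s -> s <= dist d p q ->
  n <= W -> n * \sum_(x < E ^ d) collide d p q x <= 2 * E ^ d.
Proof.
move=> n0 hA hs nW; rewrite sum_collide.
have := collisions_le d p q 0 0; have := survive_dist d p q.
have ht : n * A ^ dist d p q <= E ^ dist d p q.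
  by rewrite -(subnKC hs) !expnD mulnA leq_mul // leq_expl // leq_addr.
have Et : 0 < E ^ dist d p q by rewrite expn_gt0 E0.
move: (collisions _ _ _ _ _) (survive _ _ _) ht Et => c u ht Et hu hc.
have hu' : n * u <= E ^ d.
  rewrite -(leq_pmul2r Et) -mulnA hu mulnA [leqRHS]mulnC leq_mul2r ht orbT //.
have : W * (n * c) <= W * (2 * E ^ d).
  have : n * (W * c) <= n * (W * u + E ^ d) by rewrite leq_mul2l hc orbT.
  have : W * (n * u) <= W * E ^ d by rewrite leq_mul2l hu' orbT.
  have : n * E ^ d <= W * E ^ d by rewrite leq_mul2r nW orbT.
  by lia.
by rewrite leq_pmul2l.
Qed.

Lemma near_collisions L r d p q : 0 < A -> E ^ r <= L * A ^ r -> dist d p q <= r ->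
  E ^ d <= L * \sum_(x < E ^ d) collide d p q x.
Proof.
move=> A0 hA hs; rewrite sum_collide.
have := survive_le_collisions d p q 0; have := survive_dist d p q.
have ht : E ^ dist d p q <= L * A ^ dist d p q.
  have Ar : 0 < A ^ (r - dist d p q) by rewrite expn_gt0 A0.
  rewrite -(leq_pmul2r Ar) -mulnA -expnD subnKC //; apply: leq_trans hA.
  rewrite -{2}(subnKC hs) expnD leq_mul2l; apply/orP; right.
  by rewrite leq_expl // leq_addr.
have Et : 0 < E ^ dist d p q by rewrite expn_gt0 E0.
move: (collisions _ _ _ _ _) (survive _ _ _) ht Et => c u ht Et hu hc.
apply: leq_trans (_ : L * u <= _); last by rewrite leq_mul2l hc orbT.
by rewrite -(leq_pmul2r Et) -mulnA hu mulnA mulnC leq_mul2r ht orbT.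
Qed.

End Collision.

(** This is [(1 - x) ^ L * (1 + L x) <= 1] for [x = g / Y]. Once [L x >= 1], it gives
    [(1 - x) ^ L <= 1 / 2] without any exponential function. *)
Lemma expn_complement L Y g : g <= Y -> (Y - g) ^ L * (Y + L * g) <= Y ^ L.+1.
Proof.
move=> gY; elim: L => [|L IH]; first by rewrite expn0 mul0n addn0 mul1n expn1.
rewrite expnSr [leqRHS]expnSr -mulnA.
apply: leq_trans (_ : (Y - g) ^ L * ((Y + L * g) * Y) <= _).
  rewrite leq_mul2l; apply/orP; right.
  by move: (subnK gY); move: (Y - g) => h <-; nia.
by rewrite mulnA leq_mul2r IH orbT.
Qed.

Lemma double_expn_complement L Y g : 0 < Y -> g <= Y -> Y <= L * g -> 2 * (Y - g) ^ L <= Y ^ L.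
Proof.
move=> Y0 gY h; rewrite -(leq_pmul2r Y0) -expnSr; apply: leq_trans (expn_complement L gY).
by rewrite mulnAC mulnC leq_mul2l; apply/orP; right; lia.
Qed.

Lemma markov_sum N (F : nat -> nat) k : k * \sum_(x < N) (k <= F x) <= \sum_(x < N) F x.
Proof.
by rewrite big_distrr /=; apply: leq_sum => x _; case: (leqP k (F x)); rewrite ?muln1 ?muln0.
Qed.

Lemma sum_negb N (P : nat -> bool) : \sum_(x < N) ~~ P x = N - \sum_(x < N) P x.
Proof.
have : \sum_(x < N) ~~ P x + \sum_(x < N) P x = N.
  rewrite -big_split /=; transitivity (\sum_(x < N) 1); last first.
    by rewrite sum_nat_const card_ord muln1.
  by apply: eq_bigr => i _; case: (P i).
by move=> h; rewrite -[N in N - _]h addnK.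
Qed.

(** Rests on [2 * 27 <= 64]: three independent failures of probability 3/4 occur together with
    probability at most 1/2. *)
Lemma expn_3_4 k : 2 ^ k * 3 ^ (3 * k) <= 4 ^ (3 * k).
Proof. by rewrite !expnM -expnMn leq_expl. Qed.

Lemma sum_bool_le N (P : nat -> bool) : \sum_(x < N) P x <= N.
Proof.
apply: leq_trans (_ : \sum_(x < N) 1 <= _); last by rewrite sum_nat_const card_ord muln1.
by apply: leq_sum => x _; case: (P x).
Qed.

(** * Failure probability of one copy and of all copies *)

Section Copies.
Variables (n d s A W : nat) (pts : nat -> nat -> bool) (q : nat -> bool).
Hypothesis (W0 : 0 < W).
Let E := A + W.
Let Y := E ^ d.

Definition far p := s <= dist d (pts p) q.

Definition far_hits (hit : nat -> nat -> bool) L :=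
  \sum_(l < L) \sum_(p < n) far p && hit l p.

(** A sufficient condition for success that does not depend on the order of visits. Any revealed
    point that is not far is a legitimate answer, near or not. *)
Definition good_copy L cut (hit : nat -> nat -> bool) :=
  [exists l : 'I_L, [exists p : 'I_n, hit l p && ~~ far p]] && (far_hits hit L < cut).

Definition hit_in x l p := collide A W d (pts p) q (digit Y x l).

Lemma bad_copies L r p0 : n <= W -> 0 < A -> 0 < L -> n * A ^ s <= E ^ s ->
  E ^ r <= L * A ^ r -> r < s -> p0 < n -> dist d (pts p0) q <= r ->
  4 * \sum_(b < Y ^ L) ~~ good_copy L (8 * L) (hit_in b) <= 3 * Y ^ L.
Proof.
move=> nW A0 L0 hs hr rs p0n hp0.
have Y0 : 0 < Y by rewrite expn_gt0 /E addn_gt0 A0.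
pose X1 := \sum_(b < Y ^ L) \prod_(l < L) ~~ hit_in b l p0.
pose X2 := \sum_(b < Y ^ L) (8 * L <= far_hits (hit_in b) L).
(* A copy fails only if all its tables miss [p0] or its far hits reach the budget. *)
have hX : \sum_(b < Y ^ L) ~~ good_copy L (8 * L) (hit_in b) <= X1 + X2.
  rewrite /X1 /X2 -big_split /=; apply: leq_sum => b _.
  rewrite /good_copy negb_and -leqNgt.
  case: (leqP (8 * L) (far_hits _ _)) => _; rewrite ?orbT ?addn1 // orbF addn0.
  case: existsP => //= h; rewrite big1 // => l _.
  case hl : (hit_in b l p0) => //; case: h; exists l.
  apply/existsP; exists (Ordinal p0n); rewrite /= hl /far -ltnNge.
  exact: leq_ltn_trans rs.
have h1 : 2 * X1 <= Y ^ L.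
  pose P x := collide A W d (pts p0) q x.
  have -> : X1 = (Y - \sum_(x < Y) P x) ^ L.
    by rewrite -sum_negb -(sum_prod_digit _ (fun x => ~~ P x)).
  apply: double_expn_complement => //; first exact: sum_bool_le.
  exact: (near_collisions W0 A0 hr hp0).
(* A table meets at most 2 far points on average, from [n] points with probability at most [2 / n]
   each. A copy thus meets [2 L], a quarter of its budget. *)
have h2 : 4 * X2 <= Y ^ L.
  pose f x := \sum_(p < n) far p && collide A W d (pts p) q x.
  have hf : \sum_(x < Y) f x <= 2 * Y.
    have n0 : 0 < n by exact: leq_ltn_trans p0n.
    rewrite -(leq_pmul2l n0) exchange_big /= big_distrr /=.
    apply: leq_trans (_ : \sum_(p < n) 2 * Y <= _); last by rewrite sum_nat_const card_ord.
    apply: leq_sum => p _; case hp : (far p); last by rewrite big1 // muln0.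
    exact: (far_collisions W0 n0 hs hp nW).
  have := markov_sum (Y ^ L) (fun b => far_hits (hit_in b) L) (8 * L).
  rewrite -/X2; have := sum_sum_digit L f Y0.
  rewrite -[\sum_(v < Y ^ L) _]/(\sum_(b < Y ^ L) far_hits (hit_in b) L).
  move: (\sum_(b < _) far_hits _ _) (\sum_(x < Y) f x) hf => G F hF hG hX2.
  have hG2 : G <= 2 * L * Y ^ L.
    rewrite -(leq_pmul2l Y0) hG; move: (Y ^ L) => Z.
    by apply: leq_trans (_ : L * Z * (2 * Y) <= _); [rewrite leq_mul2l hF orbT | lia].
  rewrite -(leq_pmul2l L0) -(leq_pmul2l (isT : 0 < 2)); move: (Y ^ L) hG2 => Z hG2; lia.
by lia.
Qed.

Lemma bad_seeds L r p0 k : n <= W -> 0 < A -> 0 < L -> n * A ^ s <= E ^ s ->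
  E ^ r <= L * A ^ r -> r < s -> p0 < n -> dist d (pts p0) q <= r ->
  2 ^ k * \sum_(v < (Y ^ L) ^ (3 * k)) \prod_(m < 3 * k)
       ~~ good_copy L (8 * L) (hit_in (digit (Y ^ L) v m)) <= (Y ^ L) ^ (3 * k).
Proof.
move=> nW A0 L0 hs hr rs p0n hp0.
have Z0 : 0 < Y ^ L by rewrite !expn_gt0 /E addn_gt0 A0.
rewrite (sum_prod_digit _ (fun b => ~~ good_copy L (8 * L) (hit_in b))) //.
suff key b Z : 4 * b <= 3 * Z -> 2 ^ k * b ^ (3 * k) <= Z ^ (3 * k).
  exact: key (bad_copies nW A0 L0 hs hr rs p0n hp0).
move=> hb.
have := leq_expl (3 * k) hb; rewrite !expnMn => h.
have h4 : 0 < 4 ^ (3 * k) by rewrite expn_gt0.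
rewrite -(leq_pmul2l h4) mulnCA; apply: leq_trans (_ : 2 ^ k * (3 ^ (3 * k) * Z ^ (3 * k)) <= _).
  by rewrite leq_mul2l h orbT.
by rewrite mulnA leq_mul2r expn_3_4 orbT.
Qed.

End Copies.

(** * Verification conditions for the machine *)

Section Logic.
Variables (K V Vm Z : nat) (inp0 : seq nat) (timed : bool).
Hypothesis VmV : Vm <= V.
Hypothesis inpV : all (leq^~ V) inp0.

(** Registers and memory have separate bounds on their entries: a register must hold the whole seed,
    whereas each of the [Z] memory cells has to stay short for the space bound. *)
Definition ok_regs r := (size r <= K) && all (leq^~ V) r.
Definition ok_mem m := (size m <= Z) && all (leq^~ Vm) m.
Definition ok (s : config) := [&& ok_regs (regs s), ok_mem (Defs.mem s) & inp s == inp0].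

Definition is_rand p := if p is Rand _ _ then true else false.

(** A stretch without random draws, all of whose configurations obey the bounds. It yields costs,
    uniqueness of the execution, and probabilities. *)
Inductive runs : nat -> config -> config -> Prop :=
  | runs0 s : ok s -> runs 0 s s
  | runsS n s s' p k : ok s -> ctrl s = p :: k -> ~~ is_rand p ->
      runs n (step 0 s) s' -> runs n.+1 s s'.

Lemma runs_ok1 n s s' : runs n s s' -> ok s.
Proof. by case. Qed.

Lemma runs_ok2 n s s' : runs n s s' -> ok s'.
Proof. by elim. Qed.

Lemma runs_trans n1 n2 s1 s2 s3 : runs n1 s1 s2 -> runs n2 s2 s3 -> runs (n1 + n2) s1 s3.
Proof.
move=> h; elim: h n2 s3 => // n s s' p k oks hc hr _ IH n2 s3 /IH h.
by apply: (runsS oks hc hr h).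
Qed.

(** The limit of [T] steps is imposed only when [timed] is set. *)
Definition tri p T r m (Q : seq nat -> seq nat -> Prop) : Prop :=
  ok_regs r -> ok_mem m -> forall k, exists n r' m',
   [/\ timed ==> (n <= T), runs n (Config (p :: k) r m inp0) (Config k r' m' inp0) & Q r' m'].

Lemma tri_conseq p T T' r m (Q Q' : seq nat -> seq nat -> Prop) :
  tri p T r m Q -> timed ==> (T <= T') -> (forall r m, Q r m -> Q' r m) -> tri p T' r m Q'.
Proof.
move=> h hT hQ okr okm k; have [n [r' [m' [h1 h2 h3]]]] := h okr okm k.
exists n, r', m'; split => //; last exact: hQ.
by move: h1 hT; case: timed => //= h1; exact: leq_trans.
Qed.

Variable LB : nat.

(** An inner loop is charged [LB] steps. *)
Fixpoint wp p (Q : seq nat -> seq nat -> Prop) r m : Prop :=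
  match p with
  | Skip => Q r m
  | Const x a => a <= V /\ Q (set_nth 0 r x a) m
  | Bin o x y z =>
      let v := eval_binop o (nth 0 r y) (nth 0 r z) in
      match o with Add | Mul => v <= V | _ => True end /\ Q (set_nth 0 r x v) m
  | Read x y => Q (set_nth 0 r x (nth 0 m (nth 0 r y))) m
  | Write x y => [/\ nth 0 r x < Z, nth 0 r y <= Vm
                   & Q r (set_nth 0 m (nth 0 r x) (nth 0 r y))]
  | Input x y => Q (set_nth 0 r x (nth 0 inp0 (nth 0 r y))) m
  | Rand _ _ => False
  | Seq p1 p2 => wp p1 (wp p2 Q) r m
  | If x p1 p2 => (nth 0 r x != 0 -> wp p1 Q r m) /\ (nth 0 r x = 0 -> wp p2 Q r m)
  | While x p1 => tri (While x p1) LB r m Q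
  end.

Fixpoint steps p :=
  match p with
  | Seq p1 p2 => (steps p1 + steps p2).+1
  | If _ p1 p2 => (maxn (steps p1) (steps p2)).+1
  | While _ _ => LB
  | _ => 1
  end.

Fixpoint targets_in p :=
  match p with
  | Const x _ | Bin _ x _ _ | Read x _ | Input x _ => x < K
  | Seq p1 p2 | If _ p1 p2 => targets_in p1 && targets_in p2
  | _ => true
  end.

Lemma all_nth_le B (s : seq nat) j : all (leq^~ B) s -> nth 0 s j <= B.
Proof.
move=> h; case: (ltnP j (size s)) => hj; last by rewrite nth_default.
exact: (all_nthP 0 h).
Qed.

Lemma all_set_nth_le B (s : seq nat) j v : all (leq^~ B) s -> v <= B ->
  all (leq^~ B) (set_nth 0 s j v).
Proof.
move=> h hv; apply/(all_nthP 0) => i _; rewrite nth_set_nth /=.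
by case: eqP => // _; exact: all_nth_le.
Qed.

Lemma ok_regs_set r x v : ok_regs r -> x < K -> v <= V -> ok_regs (set_nth 0 r x v).
Proof.
by case/andP=> h1 h2 hx hv; rewrite /ok_regs size_set_nth geq_max hx h1 all_set_nth_le.
Qed.

Lemma runs_step r m p k n s' : ok_regs r -> ok_mem m -> ~~ is_rand p ->
  runs n (step 0 (Config (p :: k) r m inp0)) s' -> runs n.+1 (Config (p :: k) r m inp0) s'.
Proof.
move=> okr okm hp h; apply: (@runsS _ _ _ p k) => //.
by apply/and3P.
Qed.

Lemma tri_update p x v r m (Q : seq nat -> seq nat -> Prop) : x < K -> v <= V -> ~~ is_rand p ->
  (forall k, step 0 (Config (p :: k) r m inp0) = Config k (set_nth 0 r x v) m inp0) ->
  Q (set_nth 0 r x v) m -> tri p 1 r m Q.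
Proof.
move=> xK hv hp hs hQ okr okm k; exists 1, (set_nth 0 r x v), m; split=> //.
  by rewrite implybT.
apply: runs_step => //; rewrite hs; constructor.
by rewrite /ok ok_regs_set //= okm eqxx.
Qed.

(** Among the register updates only constants, sums and products can leave the bounds: differences,
    quotients and values read are limited by what [tri] assumes of the current state. Hence the few
    side conditions of [wp]. *)
Lemma wp_tri p Q r m : targets_in p -> wp p Q r m -> tri p (steps p) r m Q.
Proof.
have aV t x : all (leq^~ V) t -> nth 0 t x <= V by exact: all_nth_le.
elim: p Q r m => /=.
- move=> Q r m _ hQ okr okm k; exists 1, r, m; split=> //; first by rewrite implybT.
  by apply: runs_step => //; constructor; apply/and3P.
- by move=> x a Q r m xK [hv hQ]; apply: (tri_update xK hv).
- move=> o x y z Q r m xK [hv hQ] okr; case/andP: (okr) => _ rV.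
  apply: (tri_update xK _ _ _ hQ) okr => //.
  case: o hv {hQ} => //= _; first by apply: leq_trans (leq_subr _ _) (aV _ _ rV).
  by apply: leq_trans (leq_div _ _) (aV _ _ rV).
- move=> x y Q r m xK hQ okr okm; case/andP: (okm) => _ mV.
  apply: (tri_update xK _ _ _ hQ) okr okm => //.
  by apply: leq_trans VmV; apply: all_nth_le.
- move=> x y Q r m _ [hx hy hQ] okr okm k; exists 1, r, (set_nth 0 m (nth 0 r x) (nth 0 r y)).
  split=> //; first by rewrite implybT.
  apply: runs_step => //; constructor; rewrite /ok okr /= eqxx andbT.
  by case/andP: okm => h1 h2; rewrite /ok_mem size_set_nth geq_max hx h1 all_set_nth_le.
- move=> x y Q r m xK hQ; apply: (tri_update xK _ _ _ hQ) => //.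
  exact: all_nth_le.
- by [].
- move=> p1 IH1 p2 IH2 Q r m /andP[t1 t2] h okr okm k.
  have [n1 [r1 [m1 [T1 P1 Q1]]]] := IH1 _ _ _ t1 h okr okm (p2 :: k).
  have /and3P[/= okr1 okm1 _] := runs_ok2 P1.
  have [n2 [r2 [m2 [T2 P2 Q2]]]] := IH2 _ _ _ t2 Q1 okr1 okm1 k.
  exists (n1 + n2).+1, r2, m2; split=> //.
    by move: T1 T2; case: timed => //= T1 T2; rewrite ltnS leq_add.
  by apply: runs_step => //; exact: runs_trans P1 P2.
- move=> x p1 IH1 p2 IH2 Q r m /andP[t1 t2] [h1 h2] okr okm k.
  have [nz|nz] := boolP (nth 0 r x != 0).
    have [n1 [r1 [m1 [T1 P1 Q1]]]] := IH1 _ _ _ t1 (h1 nz) okr okm k.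
    exists n1.+1, r1, m1; split=> //.
      by move: T1; case: timed => //= T1; rewrite ltnS leq_max T1.
    by apply: runs_step => //; rewrite /step /reg /= nz.
  have z : nth 0 r x = 0 by apply/eqP; rewrite -[_ == _]negbK.
  have [n1 [r1 [m1 [T1 P1 Q1]]]] := IH2 _ _ _ t2 (h2 z) okr okm k.
  exists n1.+1, r1, m1; split=> //.
    by move: T1; case: timed => //= T1; rewrite ltnS leq_max T1 orbT.
  by apply: runs_step => //; rewrite /step /reg /= (negPf nz).
- by [].
Qed.

Section Steps.
Variables (Q : seq nat -> seq nat -> Prop) (r m : seq nat).

Lemma wp_Skip : Q r m -> wp Skip Q r m.
Proof. by []. Qed.

Lemma wp_Const x a : a <= V -> Q (set_nth 0 r x a) m -> wp (Const x a) Q r m.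
Proof. by []. Qed.

Lemma wp_Add x y z : nth 0 r y + nth 0 r z <= V ->
  Q (set_nth 0 r x (nth 0 r y + nth 0 r z)) m -> wp (Bin Add x y z) Q r m.
Proof. by []. Qed.

Lemma wp_Mul x y z : nth 0 r y * nth 0 r z <= V ->
  Q (set_nth 0 r x (nth 0 r y * nth 0 r z)) m -> wp (Bin Mul x y z) Q r m.
Proof. by []. Qed.

Lemma wp_Sub x y z :
  Q (set_nth 0 r x (nth 0 r y - nth 0 r z)) m -> wp (Bin Defs.Sub x y z) Q r m.
Proof. by []. Qed.

Lemma wp_Div x y z :
  Q (set_nth 0 r x (nth 0 r y %/ nth 0 r z)) m -> wp (Bin Div x y z) Q r m.
Proof. by []. Qed.

Lemma wp_Read x y : Q (set_nth 0 r x (nth 0 m (nth 0 r y))) m -> wp (Read x y) Q r m.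
Proof. by []. Qed.

Lemma wp_Write x y : nth 0 r x < Z -> nth 0 r y <= Vm ->
  Q r (set_nth 0 m (nth 0 r x) (nth 0 r y)) -> wp (Write x y) Q r m.
Proof. by []. Qed.

Lemma wp_Input x y : Q (set_nth 0 r x (nth 0 inp0 (nth 0 r y))) m -> wp (Input x y) Q r m.
Proof. by []. Qed.

Lemma wp_Seq p1 p2 : wp p1 (wp p2 Q) r m -> wp (Seq p1 p2) Q r m.
Proof. by []. Qed.

Lemma wp_If x p1 p2 : (nth 0 r x != 0 -> wp p1 Q r m) ->
  (nth 0 r x = 0 -> wp p2 Q r m) -> wp (If x p1 p2) Q r m.
Proof. by []. Qed.

Lemma wp_While x p : tri (While x p) LB r m Q -> wp (While x p) Q r m.
Proof. by []. Qed.

End Steps.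

End Logic.

Arguments wp : simpl never.

(** Symbolic execution up to the next branching or loop; the bounds on intermediate
   values come first. *)
Ltac wp_run :=
  lazymatch goal with
  | |- wp _ _ _ _ _ _ _ (Seq _ _) _ _ _ => apply: wp_Seq; wp_run
  | |- wp _ _ _ _ _ _ _ Skip _ _ _ => apply: wp_Skip; wp_run
  | |- wp _ _ _ _ _ _ _ (Const _ _) _ _ _ => apply: wp_Const; [ | simpl; wp_run]
  | |- wp _ _ _ _ _ _ _ (Bin Add _ _ _) _ _ _ => apply: wp_Add; [simpl | simpl; wp_run]
  | |- wp _ _ _ _ _ _ _ (Bin Mul _ _ _) _ _ _ => apply: wp_Mul; [simpl | simpl; wp_run]
  | |- wp _ _ _ _ _ _ _ (Bin Defs.Sub _ _ _) _ _ _ => apply: wp_Sub; simpl; wp_run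
  | |- wp _ _ _ _ _ _ _ (Bin Div _ _ _) _ _ _ => apply: wp_Div; simpl; wp_run
  | |- wp _ _ _ _ _ _ _ (Read _ _) _ _ _ => apply: wp_Read; simpl; wp_run
  | |- wp _ _ _ _ _ _ _ (Write _ _) _ _ _ => apply: wp_Write; [simpl | simpl | simpl; wp_run]
  | |- wp _ _ _ _ _ _ _ (Input _ _) _ _ _ => apply: wp_Input; simpl; wp_run
  | |- wp _ _ _ _ _ _ _ (While _ _) _ _ _ => apply: wp_While
  | |- wp _ _ _ _ _ _ _ (If _ _ _) _ _ _ => apply: wp_If; simpl
  | |- _ => idtac
  end.

Section LoopRule.
Variables (K V Vm Z : nat) (inp0 : seq nat) (timed : bool) (LB : nat).
Hypothesis VmV : Vm <= V.
Hypothesis inpV : all (leq^~ V) inp0.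
Notation tri := (tri K V Vm Z inp0 timed).
Notation wp := (wp K V Vm Z inp0 timed LB).

(** The variant [J] may drop by any positive amount. Each round pays for the body and one test; the
    strict inequality leaves room for the last, failing test. *)
Lemma while_tri (I : nat -> seq nat -> seq nat -> Prop) J T x p Q r m :
  targets_in K p ->
  (forall j r m, I j r m -> nth 0 r x != 0 ->
     wp p (fun r' m' => exists2 j', j' < j & I j' r' m') r m) ->
  (forall j r m, I j r m -> nth 0 r x = 0 -> Q r m) ->
  I J r m -> timed ==> (J * (steps LB p).+1 < T) -> tri (While x p) T r m Q.
Proof.
move=> tp hb he; elim/ltn_ind: J r m T => J IH r m T hI hT okr okm k.
have [nz|z] := eqVneq (nth 0 r x) 0.
  exists 1, r, m; split; last exact: he hI nz.
    by move: hT; case: timed => //=; apply: leq_ltn_trans.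
  apply: runs_step => //; rewrite /step /= /reg /= nz /=; constructor; exact/and3P.
have [n1 [r1 [m1 [T1 P1 [j' jJ hj']]]]] :=
  wp_tri VmV inpV tp (hb _ _ _ hI z) okr okm (While x p :: k).
have /and3P[/= okr1 okm1 _] := runs_ok2 P1.
have [|n2 [r2 [m2 [T2 P2 Q2]]]] := IH j' jJ r1 m1 (j' * (steps LB p).+1).+1 hj' _ okr1 okm1 k.
  by rewrite ltnSn implybT.
exists (n1 + n2).+1, r2, m2; split=> //.
  move: T1 T2 hT; case: timed => //= T1 T2 hT.
  apply: leq_trans hT; rewrite ltnS; apply: leq_trans (leq_add T1 T2) _.
  by rewrite addnS -addSn -mulSn leq_mul2r jJ orbT.
apply: runs_step => //; rewrite /step /= /reg /= z.
exact: runs_trans P1 P2.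
Qed.

End LoopRule.

(** * From verified paths to executions, costs and probabilities *)

Section PathFacts.
Variables (K V Vm Z : nat) (inp0 : seq nat).
Hypothesis VmV : Vm <= V.
Hypothesis inpV : all (leq^~ V) inp0.
Notation runs := (runs K V Vm Z inp0).
Notation ok := (ok K V Vm Z inp0).

Definition space_bound := K * bitlen V + Z * bitlen Vm.

Lemma leq_bitlen a b : a <= b -> bitlen a <= bitlen b.
Proof. by move=> h; rewrite /bitlen ltnS leq_trunc_log. Qed.

Lemma sum_bitlen_le B k (s : seq nat) : size s <= k -> all (leq^~ B) s ->
  \sum_(a <- s) bitlen a <= k * bitlen B.
Proof.
move=> hs /allP h; apply: leq_trans (_ : size s * bitlen B <= _); last by rewrite leq_mul2r hs orbT.
rewrite -sum1_size big_distrl /= !big_seq; apply: leq_sum => a /h ha.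
by rewrite mul1n leq_bitlen.
Qed.

Lemma ok_space s : ok s -> config_space s <= space_bound.
Proof.
case/and3P=> /andP[h1 h2] /andP[h3 h4] _.
by rewrite /config_space /space_bound leq_add // sum_bitlen_le.
Qed.

(** The operand of [Const] is the only one not found in [s]; it is bounded because it appears in a
    register after the step. *)
Lemma ok_cost s : ok s -> ok (step 0 s) -> step_cost s <= 2 * bitlen V.
Proof.
move=> /and3P[/andP[_ h1] /andP[_ h2] /eqP hi] /and3P[/andP[_ h3] _ _].
have b0 a : 0 < bitlen a by [].
have rV x : bitlen (reg s x) <= bitlen V by apply: leq_bitlen; apply: all_nth_le.
have mV x : bitlen (nth 0 (Defs.mem s) x) <= bitlen V.
  by apply: leq_bitlen; apply: leq_trans VmV; apply: all_nth_le.
have iV x : bitlen (nth 0 (inp s) x) <= bitlen V.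
  by apply: leq_bitlen; rewrite hi; apply: all_nth_le.
have s2 a b : a <= bitlen V -> b <= bitlen V -> a + b <= 2 * bitlen V by lia.
have s1 a : a <= bitlen V -> a <= 2 * bitlen V by lia.
move: h3; rewrite /step_cost /step.
case: (ctrl s) => [|[|x a|o x y z|x y|x y|x y|x y|p1 p2|x p1 p2|x p1] k] //= h3;
  try (by apply: s2 || by apply: s1).
apply: s1; apply: leq_bitlen; have := all_nth_le x h3.
by rewrite nth_set_nth /= eqxx.
Qed.

Lemma runs_cat_exec n s s' t w f : runs n s s' -> exec s' t w f ->
  exists t' w', [/\ exec s t' w' f, t' <= n * (2 * bitlen V) + t & w' <= maxn space_bound w].
Proof.
elim=> {n s s'} [s oks he|n s s' p k oks hc hr hp IH /IH[t' [w' [h1 h2 h3]]]].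
  by exists t, w; split => //; rewrite leq_maxr.
exists (step_cost s + t'), (maxn (config_space s) w'); split.
- apply: exec_step h1; first by rewrite /halted hc.
  by rewrite /choices hc; case: p hr {hc}.
- by rewrite mulSn -addnA leq_add // ok_cost // (runs_ok1 hp).
- by rewrite geq_max h3 leq_max ok_space.
Qed.

(** Each step of [runs] has a single outcome, so every execution must follow it. A claim about one
    path thereby becomes a claim about all executions. *)
Lemma exec_runs_inv n s s' t w f : runs n s s' -> exec s t w f ->
  exists t' w', exec s' t' w' f /\ w <= maxn space_bound w'.
Proof.
move=> hp; elim: hp t w f => {n s s'} [s oks t w f he|n s s' p k oks hc hr hp IH t w f he].
  by exists t, w; split => //; rewrite leq_maxr.
case: he hc oks IH hp => {t w f s} [s|s v t w f].
  by rewrite /halted => h hc; rewrite hc in h.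
move=> _ hv he hc oks IH hp.
have {}hv : v < 1 by move: hv; rewrite /choices hc; case: (p) hr.
have v0 : v = 0 by case: (v) hv.
subst v; have [t' [w' [h1 h2]]] := IH _ _ _ he.
exists t', w'; split=> //; rewrite geq_max h2 andbT leq_max ok_space //.
Qed.

Lemma exec_halted_inv s t w f : exec s t w f -> halted s -> [/\ f = s, t = 0 & w = config_space s].
Proof. by move=> he h; case: he h => // s0 v t0 w0 s' /negP. Qed.

Local Open Scope ring_scope.
Import GRing.Theory.

Lemma prob_runs (R : realType) (P : config -> Prop) n s s' fuel : runs n s s' ->
  prob R P (n + fuel) s = prob R P fuel s'.
Proof.
elim=> {n s s'} // n s s' p k oks hc hr hp IH.
rewrite addSn /= /halted hc /= -IH /choices hc.
have -> : (if p is Rand _ y then maxn 1 (reg s y) else 1%N) = 1%N by case: (p) hr.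
by rewrite big_ord1 invr1 mul1r.
Qed.

Lemma prob_halted (R : realType) (P : config -> Prop) fuel s : halted s ->
  prob R P fuel s = (`[< P s >])%:R.
Proof. by case: fuel => /= [|?] ->. Qed.

End PathFacts.

(** * Layout of the data structure and query program *)

Definition num_regs := 32.

Definition seqs := foldr Seq Skip.

(** The addresses in registers 3 and 4 are parameters because the loop serves both programs:
    preprocessing hashes data points of its input array, a query hashes the point that fills it. *)
Definition hash_loop : cmd := While 2 (seqs
  [:: Input 6 3; Read 7 4; Bin Mul 7 6 7; Bin Add 5 5 7;
      Bin Add 3 3 1; Bin Add 4 4 1; Bin Defs.Sub 2 2 1]).

(** [|a - b|] is the sum of the two truncated differences; the input bit is read twice because
    register 6 is overwritten in between. *)
Definition dist_loop : cmd := While 2 (seqs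
  [:: Input 6 3; Read 7 4; Bin Defs.Sub 6 6 7; Bin Add 5 5 6;
      Input 6 3; Bin Defs.Sub 6 7 6; Bin Add 5 5 6;
      Bin Add 3 3 1; Bin Add 4 4 1; Bin Defs.Sub 2 2 1]).

Definition psum (f : nat -> nat) k := \sum_(i < k) f i.

Lemma psum0 f : psum f 0 = 0.
Proof. exact: big_ord0. Qed.

Lemma psumS f k : psum f k.+1 = psum f k + f k.
Proof. exact: big_ord_recr. Qed.

Lemma leq_psum f d k : k <= d -> psum f k <= psum f d.
Proof. by move=> kd; rewrite -(subnKC kd) /psum big_split_ord /= leq_addr. Qed.

Lemma leq_psumS f d k : k < d -> psum f k + f k <= psum f d.
Proof. by rewrite -psumS => /leq_psum. Qed.

Lemma psum_le f d b : (forall k, k < d -> f k <= b) -> psum f d <= d * b.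
Proof.
move=> h; apply: leq_trans (_ : \sum_(i < d) b <= _); first by apply: leq_sum => i _; exact: h.
by rewrite sum_nat_const card_ord.
Qed.

Lemma eq_psum f g d : (forall k, k < d -> f k = g k) -> psum f d = psum g d.
Proof. by move=> h; apply: eq_bigr => i _; exact: h. Qed.

Section Fragments.
Variables (V Vm Z : nat) (inp0 : seq nat) (timed : bool).
Hypothesis VmV : Vm <= V.
Hypothesis inpV : all (leq^~ V) inp0.
Notation tri := (tri num_regs V Vm Z inp0 timed).

(** The 16 steps per coordinate are seven commands, seven unfoldings of [Seq], the closing [Skip]
    and the loop test. The 22 for [dist_loop] arises in the same way from ten commands. *)
Lemma hash_loop_tri d T a0 ib ca acc x y tl m (Q : seq nat -> seq nat -> Prop) :
  let f k := nth 0 inp0 (ib + k) * nth 0 m (ca + k) in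
  ib + d <= V -> ca + d <= V -> acc + psum f d <= V ->
  timed ==> (16 * d < T) ->
  (forall x y, Q [:: a0, 1, 0, ib + d, ca + d, acc + psum f d, x, y & tl] m) ->
  tri hash_loop T [:: a0, 1, d, ib, ca, acc, x, y & tl] m Q.
Proof.
move=> f hib hca hacc hT hQ.
pose I j r m' := [/\ m' = m, j <= d & exists x y,
  r = [:: a0, 1, j, ib + (d - j), ca + (d - j), acc + psum f (d - j), x, y & tl]].
apply: (@while_tri _ _ _ _ _ _ 0 VmV inpV I d) => //.
- move=> j r m' [-> jd [x' [y' ->]]] j0; rewrite /= in j0 *.
  have e : d - j.-1 = (d - j).+1 by lia.
  have h1 : f (d - j) + psum f (d - j) <= psum f d.
    by rewrite addnC; apply: leq_psumS; lia.
  have ef : nth 0 inp0 (ib + (d - j)) * nth 0 m (ca + (d - j)) = f (d - j) by [].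
  clearbody f; wp_run; rewrite ?ef; try lia.
  exists j.-1; first by lia.
  split=> //; first by lia.
  exists (nth 0 inp0 (ib + (d - j))), (f (d - j)).
  by rewrite /= e psumS /= !addnA !addn1 !addnS subn1.
- by move=> j r m' [-> jd [x' [y' ->]]] /= ->; rewrite subn0; apply: hQ.
- by split=> //; exists x, y; rewrite subnn psum0 !addn0.
- by rewrite /= mulnC.
Qed.

Lemma dist_loop_tri d T a0 ib ca acc x y tl m (Q : seq nat -> seq nat -> Prop) :
  let f k := (nth 0 inp0 (ib + k) - nth 0 m (ca + k)) +
             (nth 0 m (ca + k) - nth 0 inp0 (ib + k)) in
  ib + d <= V -> ca + d <= V -> acc + psum f d <= V ->
  timed ==> (22 * d < T) ->
  (forall x y, Q [:: a0, 1, 0, ib + d, ca + d, acc + psum f d, x, y & tl] m) ->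
  tri dist_loop T [:: a0, 1, d, ib, ca, acc, x, y & tl] m Q.
Proof.
move=> f hib hca hacc hT hQ.
pose I j r m' := [/\ m' = m, j <= d & exists x y,
  r = [:: a0, 1, j, ib + (d - j), ca + (d - j), acc + psum f (d - j), x, y & tl]].
apply: (@while_tri _ _ _ _ _ _ 0 VmV inpV I d) => //.
- move=> j r m' [-> jd [x' [y' ->]]] j0; rewrite /= in j0 *.
  have e : d - j.-1 = (d - j).+1 by lia.
  have h1 : f (d - j) + psum f (d - j) <= psum f d.
    by rewrite addnC; apply: leq_psumS; lia.
  have ef : nth 0 inp0 (ib + (d - j)) - nth 0 m (ca + (d - j)) +
    (nth 0 m (ca + (d - j)) - nth 0 inp0 (ib + (d - j))) = f (d - j) by [].
  clearbody f; wp_run; try lia.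
  exists j.-1; first by lia.
  split=> //; first by lia.
  set u := nth 0 m _ - _; set v := nth 0 m _.
  exists u, v.
  by rewrite e psumS /= -ef -!addnA !addn1 !addnS subn1.
- by move=> j r m' [-> jd [x' [y' ->]]] /= ->; rewrite subn0; apply: hQ.
- by split=> //; exists x, y; rewrite subnn psum0 !addn0.
- by rewrite /= mulnC.
Qed.

End Fragments.

(** One plus the largest hit below [b], and [0] if there is none. *)
Fixpoint last_hit (h : nat -> nat) w b :=
  if b is b'.+1 then if h b' == w then b else last_hit h w b' else 0.

Lemma last_hit0 h w b p : last_hit h w b = 0 -> p < b -> h p != w.
Proof.
elim: b => //= b IH; case: eqP => // hb /IH h0.
by rewrite ltnS leq_eqVlt => /orP[/eqP->|//]; apply/eqP.
Qed.

Lemma last_hitS h w b c : last_hit h w b = c.+1 ->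
  [/\ c < b, h c = w & forall p, c < p < b -> h p != w].
Proof.
elim: b => //= b IH; case: eqP => [hb [<-]|hb /IH[h1 h2 h3]].
  by split=> // p; lia.
split=> // [|p]; first exact: leqW.
rewrite ltnS => /andP[cp]; rewrite leq_eqVlt => /orP[/eqP->|pb]; first exact/eqP.
by apply: h3; rewrite cp.
Qed.

Lemma last_hit_le h w b : last_hit h w b <= b.
Proof. by elim: b => //= b IH; case: eqP => // _; apply: leqW. Qed.

Section Layout.
Variables (n d r2 M L cut W : nat) (pts : seq nat) (coef : nat -> nat -> nat).

Definition tab_hash t p := inner d (coef t) (fun i => nth 0 pts (p * d + i)) %% W.

(** Buckets are linked lists: after the coefficients come, for each point, the preceding point of
    its bucket, and then the bucket heads. Pointers are point numbers plus 1, with 0 as end mark,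
    and lead to ever smaller numbers. *)
Definition block t :=
  mkseq (coef t) d ++ mkseq (fun j => last_hit (tab_hash t) (tab_hash t j) j) n ++
  mkseq (fun w => last_hit (tab_hash t) w n) W.

Definition prefix_len := 7 + n * d.
Definition stride := d + n + W.

(** With fewer than all blocks, this is the memory in the middle of preprocessing, as the invariant
    of [table_loop] requires. *)
Definition memory_image k := [:: n; d; r2; M; L; cut; W] ++ pts ++ flatten (mkseq block k).

Definition image_len := prefix_len + M * L * stride.

Hypothesis size_pts : size pts = n * d.

Lemma size_block t : size (block t) = stride.
Proof. by rewrite !size_cat !size_mkseq /stride addnA. Qed.

Lemma size_blocks k : size (flatten (mkseq block k)) = k * stride.
Proof.
elim: k => // k IH.
by rewrite mkseqS flatten_rcons size_cat IH size_block mulSn addnC.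
Qed.

Lemma size_memory_image k : size (memory_image k) = prefix_len + k * stride.
Proof. by rewrite /memory_image !size_cat size_blocks size_pts /prefix_len !addnA. Qed.

Lemma nth_image_pts k j : j < n * d -> nth 0 (memory_image k) (7 + j) = nth 0 pts j.
Proof. by move=> h; rewrite /memory_image nth_cat ltnNge leq_addr /= addKn nth_cat size_pts h. Qed.

Lemma nth_image_block k t j : t < k -> j < stride ->
  nth 0 (memory_image k) (prefix_len + t * stride + j) = nth 0 (block t) j.
Proof.
move=> tk js; rewrite /memory_image nth_cat ltnNge /prefix_len -!addnA leq_addr /= addKn.
rewrite nth_cat size_pts ltnNge leq_addr /= addKn.
rewrite /mkseq -(subnKC tk) -addn1 -addnA iotaD map_cat flatten_cat nth_cat add0n.
rewrite -/(mkseq block t) size_blocks ltnNge leq_addr /= addKn.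
by rewrite nth_cat size_block js.
Qed.

Lemma nth_image_coef k t i : t < k -> i < d ->
  nth 0 (memory_image k) (prefix_len + t * stride + i) = coef t i.
Proof.
move=> tk id_; rewrite nth_image_block // ?/stride; last by lia.
by rewrite /block nth_cat size_mkseq id_ nth_mkseq.
Qed.

Lemma nth_image_next k t j : t < k -> j < n ->
  nth 0 (memory_image k) (prefix_len + t * stride + (d + j)) =
  last_hit (tab_hash t) (tab_hash t j) j.
Proof.
move=> tk jn; rewrite nth_image_block // ?/stride; last by lia.
by rewrite /block !nth_cat !size_mkseq ltnNge leq_addr /= addKn jn nth_mkseq.
Qed.

Lemma nth_image_head k t w : t < k -> w < W ->
  nth 0 (memory_image k) (prefix_len + t * stride + (d + n + w)) = last_hit (tab_hash t) w n.
Proof.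
move=> tk jn; rewrite nth_image_block // ?/stride; last by lia.
rewrite /block !nth_cat !size_mkseq -addnA ltnNge leq_addr /= addKn.
by rewrite ltnNge leq_addr /= addKn nth_mkseq.
Qed.

End Layout.

(** Register 0 receives the answer before the distance is known and is reset if the candidate turns
    out to be far. *)
Definition candidate_step := seqs
  [:: Bin Defs.Sub 16 16 1; Bin Defs.Sub 4 17 1; Bin Mul 4 4 9; Const 2 7; Bin Add 4 4 2;
      Bin Add 0 4 1; Const 3 0; Const 5 0; Bin Add 2 9 3;
      dist_loop; Bin Defs.Sub 5 5 10;
      If 5 (seqs [:: Const 0 0; Bin Defs.Sub 4 18 14; Bin Defs.Sub 4 4 8; Bin Add 4 4 17;
                     Bin Defs.Sub 4 4 1; Read 17 4])
           (Const 19 0)].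

Definition next_table := seqs
  [:: Bin Defs.Sub 15 15 1; Const 3 0; Const 5 0; Bin Add 2 9 3; Bin Add 4 18 3;
      hash_loop; Bin Div 7 5 14; Bin Mul 7 7 14; Bin Defs.Sub 5 5 7;
      Bin Add 18 18 9; Bin Add 18 18 8; Bin Add 18 18 14;
      Bin Defs.Sub 4 18 14; Bin Add 4 4 5; Read 17 4].

Definition next_copy := seqs
  [:: Bin Defs.Sub 11 11 1; Const 17 0; Bin Add 15 12 17; Bin Add 16 13 17].

(** The product tests that both budget and bucket are nonempty. Once the budget is spent, the
    remaining tables of the copy are still opened, which moves register 18 on to the next copy, but
    no candidate is visited. *)
Definition query_body := Seq (Bin Mul 6 16 17)
  (If 6 candidate_step (If 15 next_table (If 11 next_copy (Const 19 0)))).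

(** Registers: 8 n, 9 d, 10 r2, 11 copies left, 12 L, 13 budget of a copy, 14 W,
   15 tables left in the copy, 16 budget left, 17 current candidate plus 1 (0 at the
   end of a bucket), 18 end of the current table, 19 running. *)
Definition query := seqs
  [:: Const 19 1; Const 1 1; Read 8 0; Read 9 1; Const 2 2; Read 10 2;
      Const 2 3; Read 11 2; Const 2 4; Read 12 2; Const 2 5; Read 13 2;
      Const 2 6; Read 14 2; Const 2 7; Bin Mul 18 8 9; Bin Add 18 18 2;
      Bin Defs.Sub 11 11 1; Bin Add 15 12 17; Bin Add 16 13 17; While 19 query_body].

(** * Correctness and running time of a query *)

Section Query.
Variables (n d r2 M L cut W : nat) (pts : seq nat) (coef : nat -> nat -> nat).
Variables (V : nat) (q : seq nat).
Notation Z := (image_len n d M L W).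
Notation mem0 := (memory_image n d r2 M L cut W pts coef (M * L)).
Hypothesis size_pts : size pts = n * d.
Hypothesis ZV : Z <= V.
Hypothesis cutV : cut * n <= V.
Hypothesis cutV1 : cut <= V.
Hypothesis dWV : d * W <= V.
Hypothesis M0 : 0 < M.
Hypothesis W0 : 0 < W.
Hypothesis d0 : 0 < d.
Hypothesis coefW : forall t i, coef t i < W.
Hypothesis ptsV : all (leq^~ 1) pts.
Hypothesis qV : all (leq^~ 1) q.

Definition query_hash t := inner d (coef t) (nth 0 q) %% W.
Definition hits t p := tab_hash d W pts coef t p == query_hash t.
Definition qdist p := psum (fun i => (nth 0 q i - nth 0 pts (p * d + i)) +
                                  (nth 0 pts (p * d + i) - nth 0 q i)) d.
Definition farther p := r2 < qdist p.
Definition copy_good m :=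
  [exists l : 'I_L, [exists p : 'I_n, hits (m * L + l) p && ~~ farther p]] &&
  (psum (fun l => psum (fun p => farther p && hits (m * L + l) p) n) L < cut).

Definition query_post (r m : seq nat) := m = mem0 /\
  ((exists p, [/\ p < n, ~~ farther p & nth 0 r 0 = (7 + p * d).+1]) \/
   (nth 0 r 0 = 0 /\ forall m, m < M -> ~~ copy_good m)).

(** A copy takes at most [L] openings of tables, [cut] candidates and one change of copy. The two
    constants 60 cover the straight-line code of a round and of the initialization. *)
Definition query_time := (1 + M * (L + cut + 1)) * (22 * d + 60) + 60.

Let tot t := psum (fun p => farther p && hits t p).

(** In copy [c], [l] tables have been opened, and the points below [b] of the last one
   are still to be visited. A positive budget means that nothing was skipped; an
   exhausted one means that at least [cut] far points were seen. *)
Definition query_inv j r m := m = mem0 /\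
  exists a0 i ib ca acc x y ml tl B p eb go,
  r = [:: a0; 1; i; ib; ca; acc; x; y; n; d; r2; ml; L; cut; W; tl; B; p; eb; go] /\
  ((go = 0 /\ query_post r m) \/
   exists c l b, let t := (c * L + l).-1 in
   [/\ [/\ a0 = 0, go = 1, c < M, ml = M - c.+1 & [/\ l <= L, tl = L - l & B <= cut]],
       eb = prefix_len n d + (c * L + l) * stride n d W,
       [/\ b <= n, (l = 0 -> b = 0),
           p = last_hit (tab_hash d W pts coef t) (query_hash t) b &
           forall c', c' < c -> ~~ copy_good c'],
       (cut + tot t b <= B + psum (fun k => tot (c * L + k) n) l) &
       (B <> 0 -> forall k p, k < l -> p < n -> hits (c * L + k) p -> ~~ farther p ->
          k.+1 = l /\ p < b)] /\ j = 1 + ml * (L + cut + 1) + tl + B).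

Let inp_le k : nth 0 q k <= 1.
Proof. exact: all_nth_le. Qed.

Let V1 : 1 <= V.
Proof. by move: ZV; rewrite /image_len /prefix_len; lia. Qed.

Let qV' : all (leq^~ V) q.
Proof. by apply/allP => x hx; apply: leq_trans V1; apply: (allP qV). Qed.

Let pts_le k : nth 0 pts k <= 1.
Proof. exact: all_nth_le. Qed.

Let addr_le c l : c < M -> l <= L ->
  prefix_len n d + (c * L + l) * stride n d W <= Z.
Proof.
move=> cM lL; rewrite leq_add2l leq_mul2r; apply/orP; right.
by apply: leq_trans (_ : c.+1 * L <= _); [rewrite mulSn; lia | rewrite leq_mul2r cM orbT].
Qed.

Let L_le : L <= V.
Proof.
apply: leq_trans (leq_trans (addr_le M0 (leqnn L)) ZV).
by rewrite mul0n add0n; apply: leq_trans (leq_addl _ _); rewrite leq_pmulr // /stride; lia.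
Qed.

Let query_inv_body j r m : query_inv j r m -> nth 0 r 19 != 0 ->
  wp num_regs V V Z q true (22 * d + 1) query_body
     (fun r' m' => exists2 j', j' < j & query_inv j' r' m') r m.
Proof.
case=> -> {m} [a0 [i [ib [ca [acc [x [y [ml [tl [B [p [eb [go [-> {r}]]]]]]]]]]]]]].
case=> [[-> //]|[c [l [b [[[-> -> cM hml [lL htl BC]] heb [bn l0 hp cbad] hcut hnear] hj]]]]] _.
set t := (c * L + l).-1 in hp hcut *.
have eZ : eb <= V by rewrite heb; apply: leq_trans ZV; apply: addr_le.
have preV : n * d + 7 <= V.
  by apply: leq_trans ZV; rewrite addnC /image_len /prefix_len; apply: leq_addr.
have totS u v : tot u v.+1 = tot u v + (farther v && hits u v) by rewrite /tot psumS.
have tot_mono u v w : v <= w -> tot u v <= tot u w.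
  exact: leq_psum.
rewrite /query_body; wp_run.
- by apply: leq_trans cutV; rewrite leq_mul //= hp; exact: leq_trans (last_hit_le _ _ _) _.
- move=> hBp.
  have B0 : B != 0 by apply: contraNneq hBp => ->.
  have [pc epc] : exists pc, p = pc.+1.
    by case: (p) hBp => [|pc]; [rewrite muln0 | exists pc].
  have [pcb hpc hno] := last_hitS (etrans (esym hp) epc).
  have [l' el] : exists l', l = l'.+1.
    by case: (l) l0 => [h0|l']; [move: (h0 erefl) pcb => -> | exists l'].
  have et : t = c * L + l' by rewrite /t el addnS.
  have tM : t < M * L.
    rewrite et; apply: leq_trans (_ : c.+1 * L <= _); last by rewrite leq_mul2r cM orbT.
    by rewrite mulSn; lia.
  have pcn : pc < n by exact: leq_trans bn.
  have pcd : pc * d + d <= n * d by rewrite addnC -mulSn leq_mul2r pcn orbT.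
  rewrite epc /candidate_step /=; wp_run; rewrite ?(subn1 pc.+1) /= ?addn0; try lia.
  apply: (dist_loop_tri (leqnn V) qV'); rewrite ?addn0; try lia.
    rewrite add0n; apply: leq_trans (_ : d * 1 <= _); last by lia.
    apply: psum_le => k kd; have := inp_le (0 + k); set u := nth 0 q _.
    rewrite [_ + 7]addnC -addnA nth_image_pts //; last by lia.
    by have := pts_le (pc * d + k); lia.
  have -> : psum (fun k => nth 0 q (0 + k) - nth 0 mem0 (pc * d + 7 + k) +
     (nth 0 mem0 (pc * d + 7 + k) - nth 0 q (0 + k))) d = qdist pc.
    apply: eq_psum => k kd; rewrite [_ + 7]addnC -addnA nth_image_pts //.
    by lia.
  move=> x' y'; wp_run.
  (* Far candidate: the budget and the number of far hits still ahead in this bucket both drop, the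
     first by exactly one and the second by at least one, which preserves the counting
     inequality. *)
  + rewrite add0n subn_eq0 -ltnNge => hfar.
    have hitpc : hits t pc by rewrite /hits hpc.
    have eE : eb = prefix_len n d + t * stride n d W + d + n + W.
      by rewrite heb el addnS -et mulSn /stride; lia.
    wp_run; try lia.
    exists (1 + ml * (L + cut + 1) + tl + (B - 1)); first by rewrite hj; lia.
    split=> //; do 13 eexists; split; first by reflexivity.
    right; exists c, l, pc; rewrite -/t; split=> //; split=> //.
    * by split=> //; split=> //; lia.
    * split=> //; [by lia | by rewrite el |].
      have -> : eb - W - n + pc.+1 - 1 = prefix_len n d + t * stride n d W + (d + pc).
        by rewrite eE; lia.
      by rewrite nth_image_next // hpc.
    * have := tot_mono t _ _ pcb; rewrite totS /farther hfar hitpc /=; lia.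
    * move=> _ k p' kl p'n hk np'.
      have [ek p'b] := hnear (elimN eqP B0) k p' kl p'n hk np'.
      split=> //; case: (ltngtP p' pc) => // [gtp|epp].
        have := hno p'; rewrite gtp p'b => /(_ isT); move: hk.
        have -> : k = l' by move: ek; rewrite el => -[].
        by rewrite -et /hits => ->.
      by move: np'; rewrite epp /farther hfar.
  + rewrite add0n => /eqP; rewrite subn_eq0 => hnear'; wp_run; try lia.
    exists 0; first by rewrite hj; lia.
    split=> //; do 13 eexists; split; first by reflexivity.
    left; split=> //; split=> //; left; exists pc; split=> //=; last by lia.
    by rewrite /farther -leqNgt.
move=> hBp.
have p0 : B != 0 -> p = 0.
  by move=> B0; move/eqP: hBp; rewrite muln_eq0 (negPf B0) => /eqP.
have no_hit p' : B != 0 -> p' < b -> ~~ hits t p'.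
  by move=> /p0 pz p'b; apply: (last_hit0 _ p'b); rewrite -hp.
(* With budget left and the current bucket exhausted, every hit of the opened tables has been
   visited, and a visit to a point that is not far would have ended the search. *)
have clean k p' : B != 0 -> k < l -> p' < n -> hits (c * L + k) p' -> farther p'.
  move=> B0 kl p'n hk; apply/negPn/negP => np'.
  have [ek p'b] := hnear (elimN eqP B0) k p' kl p'n hk np'.
  by have := no_hit p' B0 p'b; rewrite /t -ek addnS hk.
have hcut' : cut <= B + psum (fun k => tot (c * L + k) n) l.
  by apply: leq_trans hcut; exact: leq_addr.
wp_run => htl0.
- have lL' : l < L by lia.
  have tM : c * L + l < M * L.
    apply: leq_trans (_ : c.+1 * L <= _); last by rewrite leq_mul2r cM orbT.
    by rewrite mulSn; lia.
  have eZ' : eb + d + n + W <= V.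
    apply: leq_trans ZV; have := addr_le cM lL'; rewrite addnS mulSn addnCA addnC -heb.
    by rewrite /stride; lia.
  rewrite /next_table /=; wp_run; try lia.
  have hf : psum (fun k => nth 0 q (0 + k) * nth 0 mem0 (eb + k)) d =
            inner d (coef (c * L + l)) (nth 0 q).
    apply: (@eq_psum _ (fun k => nth 0 q k * coef (c * L + l) k)) => k kd.
    by rewrite heb nth_image_coef.
  have hfle : inner d (coef (c * L + l)) (nth 0 q) <= d * W.
    apply: (@psum_le (fun k => nth 0 q k * coef (c * L + l) k)) => k _.
    by rewrite -[leqRHS]mul1n leq_mul // ltnW.
  rewrite !addn0; apply: (hash_loop_tri (leqnn V) qV'); rewrite ?hf; try lia.
  move=> x' y'; rewrite add0n; set S := inner _ _ _ in hfle *.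
  have hmod : S - S %/ W * W = S %% W by rewrite {1}(divn_eq S W) addKn.
  have modW : S %% W < W by rewrite ltn_mod.
  wp_run; rewrite ?hmod; try lia.
  exists (1 + ml * (L + cut + 1) + (tl - 1) + B); first by rewrite hj; lia.
  split=> //; do 13 eexists; split; first by reflexivity.
  right; exists c, l.+1, n; rewrite addnS /=; split=> //; split=> //.
  + by split=> //; split=> //; lia.
  + by rewrite heb mulSn /stride; lia.
  + split=> //.
    have -> : eb + d + n + W - W + S %% W =
              prefix_len n d + (c * L + l) * stride n d W + (d + n + S %% W).
      by rewrite heb; lia.
    by rewrite nth_image_head.
  + by rewrite psumS; lia.
  + move=> /eqP B0 k p'; rewrite ltnS leq_eqVlt => /orP[/eqP->//|kl] p'n hk.
    by rewrite (clean k p' B0 kl p'n hk).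
have lEL : l = L by lia.
(* If the budget is spent, the far hits number at least [cut]; if not, all hits were visited and all
   are far. Either way one half of [copy_good] fails. *)
have badc : ~~ copy_good c.
  apply/negP => /andP[/existsP[k /existsP[p' /andP[hk np']]] hlt].
  have [B0|B0] := eqVneq B 0.
    by move: hcut'; rewrite B0 add0n lEL leqNgt hlt.
  by move: np'; rewrite (clean k p') // lEL.
have badc' c' : c' <= c -> ~~ copy_good c'.
  by rewrite leq_eqVlt => /orP[/eqP-> //|/cbad].
wp_run => hml0.
- rewrite /next_copy /=; wp_run; rewrite ?addn0; try lia.
  exists (1 + (ml - 1) * (L + cut + 1) + L + cut).
    by rewrite hj; have -> : ml = (ml - 1).+1 by [lia]; rewrite mulSn; lia.
  split=> //; do 13 eexists; split; first by reflexivity.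
  right; exists c.+1, 0, 0; split=> //; split=> //.
  + by split=> //; [lia | lia | split; lia].
  + by rewrite heb lEL mulSn addn0 addnC [c * L + L]addnC addnC.
  + by rewrite /tot !psum0.
- wp_run => //; exists 0; first by rewrite hj; lia.
  split=> //; do 13 eexists; split; first by reflexivity.
  left; split=> //; split=> //; right; split=> // m mM; apply: badc'; lia.
Qed.

Lemma query_tri : tri num_regs V V Z q true query query_time [::] mem0 query_post.
Proof.
have preV : 7 + n * d <= V by apply: leq_trans ZV; exact: leq_addr.
apply: (@tri_conseq _ _ _ _ _ _ _ (steps (query_time - 60) query)) (fun _ _ h => h).
  apply: (wp_tri (leqnn V) qV'); [by [] | rewrite /query /=; wp_run; rewrite ?addn0; try lia].
  apply: (@while_tri _ _ _ _ _ _ (22 * d + 1) (leqnn V) qV' query_inv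
           (1 + (M - 1) * (L + cut + 1) + L + cut)) => //.
  - move=> j r m [-> [a0 [i [ib [ca [acc [x [y [ml [tl [B [p [eb [go [-> h]]]]]]]]]]]]]]] /= hgo.
    apply: wp_Skip; case: h => [[_ //]|[c [l [b [[[_ g1 _ _ _] _ _ _ _] _]]]]].
    by rewrite g1 in hgo.
  - split=> //; do 13 eexists; split; first by reflexivity.
    right; exists 0, 0, 0; split=> //; split=> //.
    + by split=> //; split=> //; rewrite subn0.
    + by rewrite mul0n addn0 mul0n addn0 /prefix_len addnC.
    + by rewrite /tot !psum0.
  - rewrite /= /query_time addnK.
    have -> : 1 + (M - 1) * (L + cut + 1) + L + cut = M * (L + cut + 1).
      by have {2}-> : M = (M - 1).+1 by [lia]; rewrite mulSn; lia.
    by rewrite mulnDl mul1n; apply: leq_ltn_trans (_ : _ <= M * (L + cut + 1) * (22 * d + 60)) _;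
      [rewrite leq_mul2l; apply/orP; right; lia | lia].
by rewrite /= /query_time; lia.
Qed.

End Query.

(** * Preprocessing program *)

(** Register 0 is never written during preprocessing and stays 0, so adding it amounts to
    copying. *)
Notation move_reg x y := (Bin Add x y 0).

Definition pow_loop := While 2 (seqs [:: Bin Mul 5 5 3; Bin Defs.Sub 2 2 1]).

Definition halving_loop := While 6 (seqs [:: Bin Div 6 6 7; Bin Add 12 12 1]).

(** Values of [A] are tried in increasing order and the last success is kept. Exhaustive search is
    acceptable, since only the space of preprocessing is limited. *)
Definition search_loop := While 20 (seqs
  [:: move_reg 2 25; move_reg 3 22; move_reg 5 8; pow_loop; move_reg 23 5;
      move_reg 2 25; Bin Add 3 22 8; Const 5 1; pow_loop;
      Bin Defs.Sub 24 23 5; If 24 Skip (move_reg 16 22);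
      Bin Add 22 22 1; Bin Defs.Sub 20 20 1]).

Definition lsh_params := seqs
  [:: move_reg 15 8; Bin Add 25 11 1;
      move_reg 12 9; Bin Mul 6 8 8; Const 7 2; halving_loop; Const 7 3; Bin Mul 12 12 7;
      Bin Mul 20 25 8; Bin Add 20 20 20; Const 22 0; search_loop;
      Bin Add 17 16 15;
      move_reg 2 10; move_reg 3 17; Const 5 1; pow_loop; move_reg 23 5;
      move_reg 2 10; move_reg 3 16; Const 5 1; pow_loop; Bin Div 13 23 5; Bin Add 13 13 1;
      Const 7 8; Bin Mul 14 13 7].

Definition seed_range := seqs
  [:: Bin Mul 20 12 13; Bin Mul 2 20 9; move_reg 3 17; Const 5 1; pow_loop].

(** Registers: 8 n, 9 d, 10 r1, 11 r2, 12 M, 13 L, 14 budget of a copy, 15 W, 16 A,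
   17 E, 18 seed, 19 size of the memory, 20 loop counter, 21 address of the current
   coefficients. *)
Definition choose_params := Seq (seqs
  [:: Const 27 0; Const 1 1; Input 8 0; Input 9 1; Const 2 2; Input 10 2;
      Const 2 3; Input 11 2; Const 12 1; Const 13 1; Const 14 1; Const 15 1; Const 17 1;
      Bin Defs.Sub 6 9 11;
      If 6 (Seq (Bin Defs.Sub 7 8 9) (If 7 lsh_params (move_reg 14 8))) Skip])
  seed_range.

Definition copy_loop := While 2 (seqs
  [:: Input 6 3; Write 19 6; Bin Add 3 3 1; Bin Add 19 19 1; Bin Defs.Sub 2 2 1]).

Definition decode_loop := While 2 (seqs
  [:: Bin Div 6 18 17; Bin Mul 7 6 17; Bin Defs.Sub 7 18 7; Bin Defs.Sub 7 7 16;
      move_reg 18 6; Write 19 7; Bin Add 19 19 1; Bin Defs.Sub 2 2 1]).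

Definition hash_point p := seqs
  [:: Const 3 4; Bin Mul 6 p 9; Bin Add 3 3 6; move_reg 4 21; move_reg 2 9; Const 5 0;
      hash_loop; Bin Div 7 5 15; Bin Mul 7 7 15; Bin Defs.Sub 5 5 7].

(** All hashes are recomputed for each entry. This is slow but needs no scratch memory, and cells
    are written once in the order of addresses, so that the memory is always a prefix of the final
    image. *)
Definition chain_loop := While 25 (seqs
  [:: hash_point 26; Bin Defs.Sub 6 5 23; Bin Defs.Sub 7 23 5; Bin Add 6 6 7;
      Bin Add 26 26 1; If 6 Skip (move_reg 24 26); Bin Defs.Sub 25 25 1]).

Definition store_entry := seqs
  [:: Const 24 0; Const 26 0; chain_loop;
      Write 19 24; Bin Add 19 19 1; Bin Add 22 22 1; Bin Defs.Sub 27 27 1].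

Definition entry_loop := While 27 (seqs
  [:: Bin Defs.Sub 6 8 22;
      If 6 (seqs [:: hash_point 22; move_reg 23 5; move_reg 25 22])
           (seqs [:: Bin Defs.Sub 23 22 8; move_reg 25 8]);
      store_entry]).

Definition table_loop := While 20 (seqs
  [:: move_reg 21 19; move_reg 2 9; decode_loop;
      Const 22 0; Bin Add 27 8 15; entry_loop; Bin Defs.Sub 20 20 1]).

Definition build := seqs
  [:: Const 19 0; Write 19 8; Const 19 1; Write 19 9; Const 19 2; Write 19 11;
      Const 19 3; Write 19 12; Const 19 4; Write 19 13; Const 19 5; Write 19 14;
      Const 19 6; Write 19 15; Const 19 7;
      Bin Mul 2 8 9; Const 3 4; copy_loop; table_loop].

Definition preprocess := Seq choose_params (Seq (Rand 18 5) build).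

Lemma set_nth_size (m : seq nat) k v : k = size m -> set_nth 0 m k v = rcons m v.
Proof. by move->; elim: m => //= a m ->. Qed.

Fixpoint search_zeros n s k :=
  if k is k'.+1 then if n * k' ^ s <= (k' + n) ^ s then k' else search_zeros n s k' else 0.

Section Params.
Variables (n d r1 r2 : nat).

Definition is_lsh := (r2 < d) && (d < n).
Definition param_W := if is_lsh then n else 1.
Definition param_A := if is_lsh then search_zeros n r2.+1 (2 * (r2.+1 * n)) else 0.
Definition param_E := param_A + param_W.
Definition param_M := if is_lsh then 3 * (d + bitlen (n * n)) else 1.
Definition param_L := if is_lsh then param_E ^ r1 %/ param_A ^ r1 + 1 else 1.
(** [8 L] is the Markov budget. Outside the regime [is_lsh] all points share one bucket: if
    [d <= r2], no point is far and one visit suffices; otherwise [n] visits exhaust the bucket. *)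
Definition param_cut := if is_lsh then 8 * param_L else if d <= r2 then 1 else n.

Lemma param_M_gt0 : 0 < d -> 0 < param_M.
Proof. by move=> d0; rewrite /param_M; case: ifP; rewrite // muln_gt0 addn_gt0 d0. Qed.

Lemma param_L_gt0 : 0 < param_L.
Proof. by rewrite /param_L; case: ifP; rewrite // addn1. Qed.

Lemma param_W_bounds : 0 < n -> 0 < param_W <= n.
Proof. by move=> n0; rewrite /param_W; case: ifP; rewrite ?leqnn ?n0. Qed.

Definition seed_coef v t i := digit param_E v (d * t + i) - param_A.

Lemma seed_coef_lt v t i : 0 < n -> seed_coef v t i < param_W.
Proof.
move=> n0; have /andP[W0 _] := param_W_bounds n0.
have : digit param_E v (d * t + i) < param_A + param_W.
  by apply: ltn_pmod; rewrite addn_gt0 W0 orbT.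
by rewrite /seed_coef; lia.
Qed.

End Params.

(** * Correctness of the preprocessing program *)

Section Pre.
Variables (n d r1 r2 : nat) (pts : seq nat).
Variables (V Vm : nat).
Notation W := (param_W n d r2).
Notation A := (param_A n d r2).
Notation E := (param_E n d r2).
Notation M := (param_M n d r2).
Notation L := (param_L n d r1 r2).
Notation cut := (param_cut n d r1 r2).
Notation Z := (image_len n d M L W).
Notation inp0 := ([:: n; d; r1; r2] ++ pts).
Hypothesis size_pts : size pts = n * d.
Hypothesis ZV : Z <= V.
Hypothesis VmV : Vm <= V.
Hypothesis inpV : all (leq^~ V) inp0.
Hypothesis ptsV : all (leq^~ 1) pts.
Hypothesis n0 : 0 < n.
Hypothesis d0 : 0 < d.
Notation tri := (tri num_regs V Vm Z inp0 false).
Notation wp := (wp num_regs V Vm Z inp0 false 0).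

(** The bound uses [b.+1] because powers of [b] need not increase: for [b = 0] the initial value
    exceeds the final one. *)
Lemma pow_loop_tri e T a0 b ca acc x y tl m (Q : seq nat -> seq nat -> Prop) :
  acc * b.+1 ^ e <= V -> Q [:: a0, 1, 0, b, ca, acc * b ^ e, x, y & tl] m ->
  tri pow_loop T [:: a0, 1, e, b, ca, acc, x, y & tl] m Q.
Proof.
move=> hV hQ.
pose I j r m' := [/\ m' = m, j <= e &
  r = [:: a0, 1, j, b, ca, acc * b ^ (e - j), x, y & tl]].
apply: (@while_tri _ _ _ _ _ _ 0 VmV inpV I e) => //.
- move=> j r m' [-> je ->] j0; rewrite /= in j0 *; wp_run.
    apply: leq_trans hV; rewrite -mulnA -expnSr leq_mul2l; apply/orP; right.
    apply: leq_trans (_ : b.+1 ^ (e - j).+1 <= _); first exact: leq_expl.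
    by rewrite leq_pexp2l //; lia.
  exists j.-1; first by lia.
  split=> //; first by lia.
  have -> : e - j.-1 = (e - j).+1 by lia.
  by rewrite expnSr mulnA subn1.
- by move=> j r m' [-> jd ->] /= ->; rewrite subn0.
- by split=> //; rewrite subnn expn0 muln1.
Qed.

Lemma halving_loop_tri x T a0 i ib ca acc b8 b9 b10 b11 c tl m (Q : seq nat -> seq nat -> Prop) :
  0 < x -> c + bitlen x <= V ->
  Q [:: a0, 1, i, ib, ca, acc, 0, 2, b8, b9, b10, b11, c + bitlen x & tl] m ->
  tri halving_loop T [:: a0, 1, i, ib, ca, acc, x, 2, b8, b9, b10, b11, c & tl] m Q.
Proof.
move=> x0 hV hQ.
pose I j r m' := [/\ m' = m, j <= bitlen x &
  r = [:: a0, 1, i, ib, ca, acc, x %/ 2 ^ (bitlen x - j), 2, b8, b9, b10, b11,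
       c + (bitlen x - j) & tl]].
have /andP[lo hi] : 2 ^ (bitlen x).-1 <= x < 2 ^ bitlen x by exact: trunc_log_bounds.
apply: (@while_tri _ _ _ _ _ _ 0 VmV inpV I (bitlen x)) => //.
- move=> j r m' [-> je ->] j0; rewrite /= in j0 *.
  have j1 : 0 < j by rewrite lt0n; apply: contraNneq j0 => ->; rewrite subn0 divn_small.
  wp_run; first by lia.
  exists j.-1; first by lia.
  split=> //; first by lia.
  have -> : bitlen x - j.-1 = (bitlen x - j).+1 by lia.
  by rewrite -divnMA expnSr addn1 addnS.
- move=> j r m' [-> je ->] /= /eqP; have [->|j0] := posnP j; first by rewrite divn_small ?subn0.
  rewrite -leqn0 leqNgt divn_gt0 ?expn_gt0 //.
  by rewrite (leq_trans _ lo) // leq_exp2l //; lia.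
- by split=> //; rewrite subnn expn0 divn1 addn0.
Qed.

Lemma search_loop_tri s K T i ib ca acc x y b9 b10 b11 b12 b13 b14 b15 b17 b18 b19 b21
    b23 b24 b26 b27 m (Q : seq nat -> seq nat -> Prop) :
  n * (K + n) ^ s <= V -> K + n <= V -> s <= V -> 0 < s ->
  (forall i ib acc b23 b24, Q [:: 0; 1; i; ib; ca; acc; x; y; n; b9; b10; b11; b12; b13; b14;
    b15; search_zeros n s K; b17; b18; b19; 0; b21; K; b23; b24; s; b26; b27] m) ->
  tri search_loop T [:: 0; 1; i; ib; ca; acc; x; y; n; b9; b10; b11; b12; b13; b14;
    b15; 0; b17; b18; b19; K; b21; 0; b23; b24; s; b26; b27] m Q.
Proof.
move=> hV hK hs s0 hQ.
pose I j r m' := [/\ m' = m, j <= K & exists i ib acc b23 b24,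
  r = [:: 0; 1; i; ib; ca; acc; x; y; n; b9; b10; b11; b12; b13; b14;
    b15; search_zeros n s (K - j); b17; b18; b19; j; b21; K - j; b23; b24; s; b26; b27]].
apply: (@while_tri _ _ _ _ _ _ 0 VmV inpV I K) => //; last 1 first.
- by split=> //; do 5 eexists; rewrite subnn.
- move=> j r m' [-> je [i' [ib' [acc' [b23' [b24' ->]]]]]] j0; rewrite /= in j0 *.
  set k := K - j; have kK : k < K by lia.
  have h1 : n * k.+1 ^ s <= V.
    by apply: leq_trans hV; rewrite leq_mul2l leq_expl ?orbT //; lia.
  have h2 : (k + n).+1 ^ s <= V.
    by apply: leq_trans hV; apply: leq_trans (leq_pmull _ n0); apply: leq_expl; lia.
  have h3 : n * k ^ s <= V by apply: leq_trans h1; rewrite leq_mul2l leq_expl ?orbT.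
  wp_run; rewrite ?addn0; try lia.
  apply: pow_loop_tri => //; wp_run; rewrite ?addn0; try lia.
  apply: pow_loop_tri; rewrite ?mul1n //; wp_run.
  + move=> h; wp_run; rewrite ?addn0; try lia.
    exists j.-1; first by lia.
    split=> //; first by lia.
    have -> : K - j.-1 = k.+1 by lia.
    by do 5 eexists; rewrite /= -subn_eq0 (negPf h) addn1 subn1.
  + move=> h; wp_run; rewrite ?addn0; try lia.
    exists j.-1; first by lia.
    split=> //; first by lia.
    have -> : K - j.-1 = k.+1 by lia.
    by do 5 eexists; rewrite /= -subn_eq0 h eqxx addn1 subn1.
- move=> j r m' [-> jd [i' [ib' [acc' [b23' [b24' ->]]]]]] /= ->; rewrite subn0; exact: hQ.
Qed.

(** The opening [Const 27 0] of [choose_params] stretches the register file to 28 entries, so that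
    all later ones have this literal shape. *)
Definition params_regs a2 a3 a4 a5 a6 a7 X ptr t a21 a22 a23 a24 a25 a26 a27 :=
  [:: 0; 1; a2; a3; a4; a5; a6; a7; n; d; r1; r2; M; L; cut; W; A; E; X; ptr; t;
      a21; a22; a23; a24; a25; a26; a27].

Hypothesis lshV : is_lsh n d r2 ->
  [/\ n * (2 * (r2.+1 * n) + n) ^ r2.+1 <= V, E.+1 ^ r1 <= V, d + bitlen (n * n) <= V,
      n * n <= V & 2 * (r2.+1 * n) + n <= V].
Hypothesis seedV : E.+1 ^ (M * L * d) <= V.
Hypothesis paramV : [/\ M <= V, L <= V, cut <= V & 8 <= V].

Let nV : n <= V. Proof. exact: (all_nth_le 0 inpV). Qed.
Let dV : d <= V. Proof. exact: (all_nth_le 1 inpV). Qed.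
Let r1V : r1 <= V. Proof. exact: (all_nth_le 2 inpV). Qed.
Let r2V : r2 <= V. Proof. exact: (all_nth_le 3 inpV). Qed.

Lemma leq_pexpn b e : 0 < e -> b < b.+1 ^ e.
Proof. by case: e => // e _; rewrite expnS leq_pmulr // expn_gt0. Qed.

Let N0 : 0 < M * L * d.
Proof. by rewrite !muln_gt0 param_M_gt0 // param_L_gt0. Qed.

Lemma choose_params_tri T (Q : seq nat -> seq nat -> Prop) :
  (forall a2 a3 a4 a6 a7 a21 a22 a23 a24 a25 a26 a27,
     Q (params_regs a2 a3 a4 (E ^ (M * L * d)) a6 a7 0 0 (M * L)
                    a21 a22 a23 a24 a25 a26 a27) [::]) ->
  tri choose_params T [::] [::] Q.
Proof.
move=> hQ; apply: (@tri_conseq _ _ _ _ _ _ _ (steps 0 choose_params)) (fun _ _ h => h) => //.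
apply: (wp_tri VmV inpV); first by [].
case: paramV => MV LV cutV V8.
(* The three parameter regimes meet here, before the range of the seed is computed. *)
have finish a2 a3 a4 a5 a6 a7 a20 a21 a22 a23 a24 a25 a26 a27 :
  wp seed_range Q
     (params_regs a2 a3 a4 a5 a6 a7 0 0 a20 a21 a22 a23 a24 a25 a26 a27) [::].
  have E0 : 0 < E by rewrite /param_E /param_W; case: ifP; rewrite ?addn1 // addn_gt0 n0 orbT.
  have N1 : M * L * d <= V.
    apply: leq_trans seedV; apply: ltnW; apply: leq_trans (ltn_expl _ (isT : 1 < 2)) _.
    exact: leq_expl.
  have E1 : E <= V by apply: leq_trans seedV; apply: ltnW; exact: leq_pexpn N0.
  rewrite /params_regs /seed_range /=; wp_run; rewrite ?addn0; try lia.
    by apply: leq_trans N1; rewrite leq_pmulr.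
  apply: pow_loop_tri; rewrite ?mul1n //; wp_run.
  exact: hQ.
rewrite /choose_params /=; wp_run; try lia; last first.
  move=> h; wp_run.
  have := finish 3 0 0 0 (d - r2) 0 0 0 0 0 0 0 0 0.
  have dr : d <= r2 by rewrite -subn_eq0 h.
  by rewrite /params_regs /param_M /param_L /param_cut /param_E /param_A /param_W
       /is_lsh ltnNge dr.
move=> /eqP h; have dr : r2 < d by lia.
wp_run; last first.
  move=> hnd; wp_run; first by rewrite addn0.
  have nd : n <= d by lia.
  have := finish 3 0 0 0 (d - r2) (n - d) 0 0 0 0 0 0 0 0.
  by rewrite /params_regs /param_M /param_L /param_cut /param_E /param_A /param_W
       /is_lsh [d < n]ltnNge nd andbF leqNgt dr addn0.
move=> /eqP hnd; have dn : d < n by lia.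
have lsh : is_lsh n d r2 by rewrite /is_lsh dr dn.
have [h1 h2 h3 h4 h5] := lshV lsh.
have eW : W = n by rewrite /param_W lsh.
have eA : A = search_zeros n r2.+1 (2 * (r2.+1 * n)) by rewrite /param_A lsh.
have eM : M = 3 * (d + bitlen (n * n)) by rewrite /param_M lsh.
have eL : L = E ^ r1 %/ A ^ r1 + 1 by rewrite /param_L lsh.
have ec : cut = 8 * L by rewrite /param_cut lsh.
have eE : E = A + n by rewrite /param_E eW.
have hE : E <= V by apply: leq_trans seedV; apply: ltnW; exact: leq_pexpn N0.
have hEr : E ^ r1 <= V by apply: leq_trans h2; exact: leq_expl.
have hAr : A.+1 ^ r1 <= V by apply: leq_trans h2; apply: leq_expl; rewrite eE; lia.
rewrite /lsh_params /=; wp_run; rewrite ?addn0; try lia.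
apply: halving_loop_tri => //; first by rewrite muln_gt0 n0.
wp_run; rewrite ?addn1 ?addn0; try lia.
rewrite [_ * 3]mulnC -eM [_ + r2.+1 * n]addnn -mul2n; apply: search_loop_tri => //; try lia.
rewrite -eA => i ib acc b23 b24; wp_run; rewrite ?addn0 -?eE; try lia.
apply: pow_loop_tri; rewrite ?mul1n //; wp_run; rewrite ?addn0 ?mul1n; try lia.
apply: pow_loop_tri; rewrite ?mul1n //; wp_run; rewrite ?mul1n -?eL; try lia.
rewrite [L * 8]mulnC -ec.
have := finish 0 A 0 (A ^ r1) 0 8.
by rewrite /params_regs eW; apply.
Qed.

Hypothesis paramVm : [/\ d <= Vm, r2 <= Vm, M <= Vm, L <= Vm & cut <= Vm].
Hypothesis nVm : n <= Vm.
Hypothesis WVm : W <= Vm.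
Hypothesis dWV : d * W <= V.

Let W0 : 0 < W. Proof. by rewrite /param_W; case: ifP. Qed.
Let E0 : 0 < E. Proof. by rewrite /param_E addn_gt0 W0 orbT. Qed.
Let V8 : 8 <= V. Proof. by case: paramV. Qed.
Let prefixZ : 7 + n * d <= Z. Proof. exact: leq_addr. Qed.

Lemma decode_loop_tri T a3 a4 a5 a6 a7 X t a21 a22 a23 a24 a25 a26 a27 m
    (Q : seq nat -> seq nat -> Prop) : size m + d <= Z ->
  (forall a6 a7, Q (params_regs 0 a3 a4 a5 a6 a7 (X %/ E ^ d) (size m + d) t
                                a21 a22 a23 a24 a25 a26 a27)
                   (m ++ mkseq (fun i => digit E X i - A) d)) ->
  tri decode_loop T (params_regs d a3 a4 a5 a6 a7 X (size m) t a21 a22 a23 a24 a25 a26 a27) m Q.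
Proof.
move=> hZ hQ okr; have XV : X <= V by case/andP: (okr) => _ /(all_nth_le 18).
move: okr.
pose I j r m' := j <= d /\ (m' = m ++ mkseq (fun i => digit E X i - A) (d - j) /\ exists a6 a7,
  r = params_regs j a3 a4 a5 a6 a7 (X %/ E ^ (d - j)) (size m + (d - j)) t
                  a21 a22 a23 a24 a25 a26 a27).
apply: (@while_tri _ _ _ _ _ _ 0 VmV inpV I d) => //; last 1 first.
- split=> //; split; first by rewrite subnn /mkseq cats0.
  by exists a6, a7; rewrite subnn expn0 divn1 addn0.
- move=> j r m' [je [-> [a6' [a7' ->]]]] j0; rewrite /= in j0 *.
  set k := d - j; have kd : k < d by lia.
  set x := X %/ E ^ k; have xV : x <= V by exact: leq_trans (leq_div _ _) XV.
  have ex : x - x %/ E * E = x %% E by rewrite {1}(divn_eq x E) addKn.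
  rewrite /params_regs; wp_run; rewrite ?ex.
  + exact: leq_trans (leq_trunc_div _ _) xV.
  + by rewrite addn0; exact: leq_trans (leq_div _ _) xV.
  + by lia.
  + apply: leq_trans WVm; rewrite leq_subLR -/E /param_E -/(param_E n d r2).
    by apply: ltnW; rewrite ltn_mod.
  + by lia.
  + exists j.-1; rewrite /I; first by lia.
    have -> : d - j.-1 = k.+1 by lia.
    split; first by lia.
    split; last first.
      by do 2 eexists; rewrite /params_regs expnSr divnMA addn0 addn1 addnS subn1.
    by rewrite set_nth_size ?size_cat ?size_mkseq // mkseqS rcons_cat.
- by move=> j r m' [je [-> [a6' [a7' ->]]]] /= ->; rewrite subn0; apply: hQ.
Qed.

Section Table.
Variables (cf : nat -> nat) (a21 : nat).
Hypothesis cfW : forall i, i < d -> cf i < W.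
Hypothesis a21V : a21 + d <= V.

Definition has_coefs (m : seq nat) := forall i, i < d -> nth 0 m (a21 + i) = cf i.
Let h p := inner d cf (fun i => nth 0 pts (p * d + i)) %% W.

Lemma hash_point_wp x p a2 a3 a4 a5 a6 a7 X ptr t a22 a23 a24 a25 a26 a27 m
    (Q : seq nat -> seq nat -> Prop) :
  (x = 22 /\ p = a22) \/ (x = 26 /\ p = a26) -> p < n -> has_coefs m ->
  (forall a2 a3 a4 a6 a7, Q (params_regs a2 a3 a4 (h p) a6 a7 X ptr t
       a21 a22 a23 a24 a25 a26 a27) m) ->
  wp (hash_point x) Q (params_regs a2 a3 a4 a5 a6 a7 X ptr t
       a21 a22 a23 a24 a25 a26 a27) m.
Proof.
move=> hx pn hm hQ; have pd : p * d + d <= n * d by rewrite addnC -mulSn leq_mul2r pn orbT.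
have hf : psum (fun k => nth 0 inp0 (4 + p * d + k) * nth 0 m (a21 + k)) d =
          inner d cf (fun i => nth 0 pts (p * d + i)).
  apply: (@eq_psum _ (fun k => nth 0 pts (p * d + k) * cf k)) => k kd.
  by rewrite hm // -addnA.
have hfle : inner d cf (fun i => nth 0 pts (p * d + i)) <= d * W.
  apply: (@psum_le (fun k => nth 0 pts (p * d + k) * cf k)) => k kd.
  rewrite -[leqRHS]mul1n leq_mul //; first exact: all_nth_le.
  exact: ltnW (cfW kd).
have suff1 a6' a7' :
  wp hash_loop (wp (seqs [:: Bin Div 7 5 15; Bin Mul 7 7 15; Bin Defs.Sub 5 5 7]) Q)
    (params_regs d (4 + p * d) a21 0 a6' a7' X ptr t a21 a22 a23 a24 a25 a26 a27) m.
  rewrite /params_regs /=; apply: wp_While.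
  apply: hash_loop_tri => //; rewrite ?hf ?add0n; try lia.
  move=> x' y'; set S := inner _ _ _ in hfle *.
  have hmod : S - S %/ W * W = S %% W by rewrite {1}(divn_eq S W) addKn.
  wp_run; first exact: leq_trans (leq_trunc_div _ _) (leq_trans hfle dWV).
  by rewrite hmod; apply: hQ.
rewrite /params_regs /= in suff1.
by case: hx => -[-> ep]; rewrite /hash_point /params_regs /=; wp_run; rewrite -?{1}ep ?addn0;
  try lia; rewrite ?ep in suff1 *; apply: suff1.
Qed.

Lemma chain_loop_tri T b w a2 a3 a4 a5 a6 a7 X ptr t a22 a27 m
    (Q : seq nat -> seq nat -> Prop) : w < W -> b <= n -> has_coefs m ->
  (forall a2 a3 a4 a5 a6 a7, Q (params_regs a2 a3 a4 a5 a6 a7 X ptr t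
       a21 a22 w (last_hit h w b) 0 b a27) m) ->
  tri chain_loop T (params_regs a2 a3 a4 a5 a6 a7 X ptr t a21 a22 w 0 b 0 a27) m Q.
Proof.
move=> wW bn hm hQ.
pose I j r m' := [/\ m' = m, j <= b & exists a2 a3 a4 a5 a6 a7,
  r = params_regs a2 a3 a4 a5 a6 a7 X ptr t a21 a22 w (last_hit h w (b - j)) j (b - j) a27].
apply: (@while_tri _ _ _ _ _ _ 0 VmV inpV I b) => //; last 1 first.
- by split=> //; do 6 eexists; rewrite subnn.
- move=> j r m' [-> jb [? [? [? [? [? [? ->]]]]]]] j0; rewrite /= in j0 *.
  set k := b - j; have kb : k < b by lia.
  apply: wp_Seq; apply: hash_point_wp; first by right.
  + by lia.
  + by [].
  move=> a2' a3' a4' a6' a7'.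
  have hW : h k < W by rewrite ltn_mod.
  have WV : W <= V by apply: leq_trans VmV.
  rewrite /params_regs /=; wp_run; try lia.
  + move=> hz; wp_run; exists j.-1; rewrite /I; first by lia.
    have -> : b - j.-1 = k.+1 by lia.
    split=> //; first by lia.
    do 6 eexists; rewrite /= ifN ?addn1 ?subn1 //.
    by apply: contraNneq hz => ->; rewrite subnn.
  + move=> hz; wp_run; rewrite ?addn0; try lia.
    exists j.-1; rewrite /I; first by lia.
    have -> : b - j.-1 = k.+1 by lia.
    split=> //; first by lia.
    do 6 eexists; rewrite /= ifT ?addn1 ?subn1 //.
    by apply/eqP; lia.
- move=> j r m' [-> jb [? [? [? [? [? [? ->]]]]]]] /= ->; rewrite subn0; exact: hQ.
Qed.

(** Successors and bucket heads form one sequence of [n + W] cells, written by a single loop: both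
    are largest hits below some bound. *)
Definition entry j := if j < n then last_hit h (h j) j else last_hit h (j - n) n.

Lemma entry_le j : entry j <= n.
Proof.
rewrite /entry; case: ltnP => jn; last exact: last_hit_le.
exact: leq_trans (last_hit_le _ _ _) (ltnW jn).
Qed.

Lemma entry_loop_tri T a2 a3 a4 a5 a6 a7 X t a23 a24 a25 a26 m
    (Q : seq nat -> seq nat -> Prop) : a21 + d <= size m -> size m + (n + W) <= Z ->
  has_coefs m ->
  (forall a2 a3 a4 a5 a6 a7 a23 a24 a25 a26,
     Q (params_regs a2 a3 a4 a5 a6 a7 X (size m + (n + W)) t a21 (n + W) a23 a24 a25 a26 0)
       (m ++ mkseq entry (n + W))) ->
  tri entry_loop T (params_regs a2 a3 a4 a5 a6 a7 X (size m) t a21 0 a23 a24 a25 a26 (n + W)) m Q.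
Proof.
move=> ham hZ hm hQ; set c := n + W.
pose I j r m' := [/\ m' = m ++ mkseq entry (c - j), j <= c &
  exists a2 a3 a4 a5 a6 a7 a23 a24 a25 a26,
  r = params_regs a2 a3 a4 a5 a6 a7 X (size m + (c - j)) t a21 (c - j) a23 a24 a25 a26 j].
apply: (@while_tri _ _ _ _ _ _ 0 VmV inpV I c) => //; last 1 first.
- by split=> //; [rewrite subnn /mkseq cats0 | do 10 eexists; rewrite subnn addn0].
- move=> j r m' [-> jc [? [? [? [? [? [? [? [? [? [? ->]]]]]]]]]]] j0; rewrite /= in j0 *.
  set k := c - j; have kc : k < c by lia.
  set m1 := m ++ _.
  have hm1 : has_coefs m1 by move=> i id_; rewrite nth_cat ifT ?hm //; lia.
  have sm1 : size m1 = size m + k by rewrite size_cat size_mkseq.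
  have rest w b a2' a3' a4' a5' a6' a7' a24' a26' : w < W -> b <= n -> last_hit h w b = entry k ->
    wp store_entry (wp Skip (fun r' m'' => exists2 j', j' < j & I j' r' m''))
      (params_regs a2' a3' a4' a5' a6' a7' X (size m + k) t a21 k w a24' b a26' j) m1.
    move=> wW bn elk; rewrite /params_regs /store_entry /=; wp_run => //.
    apply: chain_loop_tri => //; rewrite elk => ? ? ? ? ? ?; rewrite /params_regs; wp_run; try lia.
      exact: leq_trans (entry_le _) nVm.
    exists j.-1; rewrite /I; first by lia.
    have -> : c - j.-1 = k.+1 by lia.
    split; last 2 first.
    - by lia.
    - by do 10 eexists; rewrite /params_regs !addn1 addnS subn1.
    by rewrite set_nth_size // mkseqS -rcons_cat.
  have WV : W <= V by apply: leq_trans VmV.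
  rewrite /params_regs /= in rest *; wp_run => hk.
  + have kn : k < n by lia.
    wp_run; apply: (@hash_point_wp 22 k); [by left | by [] | by [] |].
    have hW : h k < W by rewrite ltn_mod.
    move=> ? ? ? ? ?; rewrite /params_regs; wp_run; rewrite ?addn0; try lia.
    by apply: rest => //; [lia | rewrite /entry kn].
  + have kn : n <= k by lia.
    wp_run; rewrite ?addn0 //.
    by apply: rest => //; [lia | rewrite /entry ltnNge kn].
- move=> j r m' [-> jc [? [? [? [? [? [? [? [? [? [? ->]]]]]]]]]]] /= ->.
  rewrite subn0; exact: hQ.
Qed.

End Table.

Variable v : nat.
Hypothesis vV : v <= V.

Notation coefv := (seed_coef n d r2 v).
Notation img := (memory_image n d r2 M L cut W pts coefv).

Lemma mkseq_entry cf : mkseq (entry cf) (n + W) =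
  let h p := inner d cf (fun i => nth 0 pts (p * d + i)) %% W in
  mkseq (fun j => last_hit h (h j) j) n ++ mkseq (fun w => last_hit h w n) W.
Proof.
rewrite /mkseq iotaD map_cat add0n; congr (_ ++ _).
  by apply/eq_in_map => j; rewrite mem_iota /entry => /andP[_ ->].
rewrite -{1}[n]addn0 iotaDl -map_comp; apply: eq_map => w /=.
by rewrite /entry ltnNge leq_addr addKn.
Qed.

(** The seed is consumed from its low end: after [k] tables register 18 holds [v] without its first
    [d k] digits, so each table is decoded by the same code. *)
Lemma table_loop_tri T a2 a3 a4 a5 a6 a7 a21 a22 a23 a24 a25 a26 a27
    (Q : seq nat -> seq nat -> Prop) : (forall r, Q r (img (M * L))) ->
  tri table_loop T (params_regs a2 a3 a4 a5 a6 a7 v (7 + n * d) (M * L)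
                      a21 a22 a23 a24 a25 a26 a27) (img 0) Q.
Proof.
move=> hQ; set c := M * L.
pose I j r m' := [/\ m' = img (c - j), j <= c &
  exists a2 a3 a4 a5 a6 a7 a21 a22 a23 a24 a25 a26 a27,
  r = params_regs a2 a3 a4 a5 a6 a7 (v %/ E ^ (d * (c - j))) (size (img (c - j))) j
        a21 a22 a23 a24 a25 a26 a27].
apply: (@while_tri _ _ _ _ _ _ 0 VmV inpV I c) => //; last 1 first.
- split; rewrite ?subnn //; do 13 eexists.
  by rewrite muln0 expn0 divn1 size_memory_image // /prefix_len addn0.
- move=> j r m' [-> jc [? [? [? [? [? [? [? [? [? [? [? [? [? ->]]]]]]]]]]]]]] j0.
  have {}j0 : j != 0 by [].
  set k := c - j; have kc : k < c by lia.
  have sk : size (img k) + (d + n + W) <= Z.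
    rewrite size_memory_image // -addnA leq_add2l addnC -/(stride n d W) -mulSn.
    by rewrite leq_mul2r kc orbT.
  have e0 : img k.+1 = img k ++ block n d W pts coefv k.
    by rewrite /memory_image mkseqS flatten_rcons !catA.
  set m := img k in sk e0 *; clearbody m; set X := v %/ _.
  have ec i : digit E X i - A = coefv k i.
    by rewrite /seed_coef /digit expnD divnMA.
  rewrite /params_regs /=; wp_run; rewrite ?addn0; try lia.
  apply: decode_loop_tri; first by lia.
  have -> : mkseq (fun i => digit E X i - A) d = mkseq (coefv k) d.
    by apply: eq_map => i; exact: ec.
  set m1 := m ++ _ => ? ?; have sm1 : size m1 = size m + d by rewrite size_cat size_mkseq.
  rewrite -sm1 /params_regs; wp_run; try lia.
  apply: (@entry_loop_tri (coefv k)); try lia.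
  + by move=> i _; exact: seed_coef_lt.
  + by move=> i id_; rewrite nth_cat ltnNge leq_addr /= addKn nth_mkseq.
  move=> ? ? ? ? ? ? ? ? ? ?; rewrite mkseq_entry /params_regs; wp_run.
  exists j.-1; rewrite /I; first by lia.
  have -> : c - j.-1 = k.+1 by lia.
  split; [by rewrite e0 /m1 /block !catA | by lia |].
  do 13 eexists; rewrite /params_regs e0 size_cat size_block /stride sm1 subn1.
  by rewrite mulnS [d + _]addnC expnD divnMA !addnA.
- move=> j r m' [-> jc [? [? [? [? [? [? [? [? [? [? [? [? [? ->]]]]]]]]]]]]]] /= ->.
  rewrite subn0; exact: hQ.
Qed.

Lemma copy_loop_tri T a4 a5 a6 a7 a21 a22 a23 a24 a25 a26 a27 t X
    (Q : seq nat -> seq nat -> Prop) :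
  (forall a6 , Q (params_regs 0 (4 + n * d) a4 a5 a6 a7 X (7 + n * d) t
                      a21 a22 a23 a24 a25 a26 a27) (img 0)) ->
  tri copy_loop T (params_regs (n * d) 4 a4 a5 a6 a7 X 7 t
                      a21 a22 a23 a24 a25 a26 a27) [:: n; d; r2; M; L; cut; W] Q.
Proof.
move=> hQ; set c := n * d.
pose I j r m' := [/\ m' = [:: n; d; r2; M; L; cut; W] ++ take (c - j) pts, j <= c &
  exists a6, r = params_regs j (4 + (c - j)) a4 a5 a6 a7 X (7 + (c - j)) t
        a21 a22 a23 a24 a25 a26 a27].
apply: (@while_tri _ _ _ _ _ _ 0 VmV inpV I c) => //; last 1 first.
- by split; rewrite ?subnn ?take0 //; exists a6; rewrite !addn0.
- move=> j r m' [-> jc [a6' ->]] j0; rewrite /= in j0 *.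
  set k := c - j; have kc : k < c by lia.
  have p1 : nth 0 pts k <= 1 by exact: all_nth_le.
  have Vm1 : 1 <= Vm by apply: leq_trans nVm.
  rewrite /params_regs; wp_run; rewrite -/c ?add0n; try lia.
  exists j.-1; rewrite /I; first by lia.
  have -> : c - j.-1 = k.+1 by lia.
  split; [| by lia |]; last by eexists; rewrite /params_regs !addn1 !addnS subn1.
  by rewrite (take_nth 0) ?size_pts // set_nth_size // size_take size_pts kc.
- move=> j r m' [-> jc [a6' ->]] /= ->; rewrite subn0 take_oversize ?size_pts //.
  by have := hQ a6'; rewrite /memory_image /= cats0.
Qed.

Lemma build_tri T a2 a3 a4 a5 a6 a7 ptr a21 a22 a23 a24 a25 a26 a27
    (Q : seq nat -> seq nat -> Prop) : (forall r, Q r (img (M * L))) ->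
  tri build T (params_regs a2 a3 a4 a5 a6 a7 v ptr (M * L)
                      a21 a22 a23 a24 a25 a26 a27) [::] Q.
Proof.
move=> hQ; apply: (@tri_conseq _ _ _ _ _ _ _ (steps 0 build)) (fun _ _ h => h) => //.
apply: (wp_tri VmV inpV); first by [].
case: paramVm => dVm r2Vm MVm LVm cutVm.
rewrite /build /params_regs /=; wp_run; try lia.
apply: copy_loop_tri => a6'; wp_run.
by apply: table_loop_tri => r; apply: wp_Skip.
Qed.

End Pre.

(** * Parameters and bad seeds *)

Lemma expn_add_bernoulli a b k : a ^ k * (a + k * b) <= a * (a + b) ^ k.
Proof.
elim: k => [|k IH]; first by rewrite !expn0 mul0n addn0 mul1n muln1.
rewrite !expnSr mulnA; apply: leq_trans (_ : a ^ k * (a + k * b) * (a + b) <= _).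
  by rewrite -!mulnA leq_mul2l; apply/orP; right; nia.
by rewrite leq_mul2r IH orbT.
Qed.

(** Bernoulli's inequality for [(1 - b / a) ^ k], multiplied out. Beyond [k b = a] the truncated
    difference makes the left side 0. *)
Lemma expn_sub_bernoulli a b k : a ^ k * (a - k * b) <= a * (a - b) ^ k.
Proof.
elim: k => [|k IH]; first by rewrite !expn0 mul0n subn0 mul1n muln1.
rewrite !expnSr mulnA; apply: leq_trans (_ : a ^ k * (a - k * b) * (a - b) <= _).
  rewrite -!mulnA leq_mul2l; apply/orP; right.
  have [h|h] := leqP (k.+1 * b) a; last by rewrite (eqP (ltnW h)) muln0.
  move: (subnK h); move: (a - k.+1 * b) => y <-; nia.
by rewrite leq_mul2r IH orbT.
Qed.

Lemma search_zerosP n s K k0 : k0 < K -> n * k0 ^ s <= (k0 + n) ^ s ->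
  let k := search_zeros n s K in
  [/\ k0 <= k < K, n * k ^ s <= (k + n) ^ s &
      forall i, k < i < K -> (i + n) ^ s < n * i ^ s].
Proof.
move=> k0K h0; elim: K k0K => // K IH k0K /=; case: ifP => hK.
  by split=> //; [lia | move=> i hi; exfalso; lia].
have k0K' : k0 < K.
  by move: k0K; rewrite ltnS leq_eqVlt => /orP[/eqP e|//]; rewrite -e h0 in hK.
have [h1 h2 h3] := IH k0K'; split=> //; first by lia.
move=> i /andP[i1]; rewrite ltnS leq_eqVlt => /orP[/eqP->|iK].
  by rewrite ltnNge hK.
by apply: h3; rewrite i1.
Qed.

Section LshParams.
Variables (n d r1 r2 : nat).
Hypothesis lsh : is_lsh n d r2.
Hypothesis d0 : 0 < d.
Let s := r2.+1.
Notation A := (param_A n d r2).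
Notation E := (param_E n d r2).
Notation L := (param_L n d r1 r2).

(* The last inequality says that [A] is maximal; the search stops at [2 s n] because
   Bernoulli's inequality rules out all larger values. *)
Lemma lsh_A : [/\ s <= A, A < 2 * (s * n), n * A ^ s <= E ^ s &
  (A.+1 + n) ^ s < n * A.+1 ^ s].
Proof.
have /andP[rd dn] := lsh; have n2 : 2 <= n by lia.
have eE : E = A + n by rewrite /param_E /param_W lsh.
have eA : A = search_zeros n s (2 * (s * n)) by rewrite /param_A lsh.
have hs : s < 2 * (s * n) by rewrite /s; nia.
(* Bernoulli for the candidate [s]: [(1 + n / s) ^ s >= 1 + n]. So the maximal [A] is at least [s],
   which later makes the rounding of [A] cheap. *)
have h0 : n * s ^ s <= (s + n) ^ s.
  rewrite -(leq_pmul2l (ltn0Sn r2)); apply: leq_trans (expn_add_bernoulli s n s).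
  by rewrite mulnCA [leqLHS]mulnA mulnC leq_mul2l -/s; apply/orP; right; lia.
have [/andP[h1 h2] h3 h4] := search_zerosP hs h0; rewrite -eA in h1 h2 h3 h4.
split=> //; first by rewrite eE.
have [hA|hA] := ltnP A.+1 (2 * (s * n)); first by apply: h4; rewrite ltnSn hA.
have X0 : 0 < A.+1 + n by lia.
rewrite -(ltn_pmul2l X0); have := expn_sub_bernoulli (A.+1 + n) n s; rewrite addnK.
move: (A.+1 ^ s) => x.
have Y0 : 0 < (A.+1 + n) ^ s by rewrite expn_gt0 X0.
(* If [A + 1 >= 2 s n], then [1 - s n / (A + 1 + n) > 1 / 2]; by Bernoulli the [s]-th power of the
   rate at [A + 1] exceeds [1 / 2], hence [1 / n]. *)
have hh : A.+1 + n < 2 * (A.+1 + n - s * n) by lia.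
move=> hb; apply: leq_trans (_ : (A.+1 + n) ^ s * (2 * (A.+1 + n - s * n)) <= _).
  by rewrite mulnC ltn_pmul2l.
rewrite mulnCA; apply: leq_trans (_ : 2 * ((A.+1 + n) * x) <= _).
  by rewrite leq_mul2l hb orbT.
by rewrite [leqRHS]mulnCA leq_mul2r n2 orbT.
Qed.

Lemma lsh_L : E ^ r1 <= L * A ^ r1.
Proof.
have [sA _ _ _] := lsh_A.
have A0 : 0 < A ^ r1 by rewrite expn_gt0 (leq_trans _ sA).
by rewrite /param_L lsh addn1 ltnW // -ltn_divLR.
Qed.

End LshParams.

Section Points.
Variables (n d : nat) (S : n.-tuple (cube d)).
Hypothesis d0 : 0 < d.

Definition flat_points := flatten [seq encode_point p | p <- S].
Definition data_point p : cube d := nth [tuple of nseq d false] S p.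
Definition data_bit p i := nth false (data_point p) i.

Lemma nth_encode (q : cube d) i : nth 0 (encode_point q) i = nth false q i.
Proof.
case: (ltnP i d) => hi; first by rewrite (nth_map false) ?size_tuple.
by rewrite !nth_default ?size_map ?size_tuple.
Qed.

Lemma size_flat_points : size flat_points = n * d.
Proof.
rewrite /flat_points -{2}(size_tuple S); elim: (tval S) => //= p s IH.
by rewrite size_cat size_map size_tuple IH mulSn.
Qed.

Lemma flat_points_le1 : all (leq^~ 1) flat_points.
Proof.
apply/allP => x /flattenP[y /mapP[p _ ->]] /mapP[b _ ->]; exact: leq_b1.
Qed.

Lemma nth_flat_points p i : p < n -> i < d ->
  nth 0 flat_points (p * d + i) = data_bit p i.
Proof.
move=> hp hi; have {}hp : p < size S by rewrite size_tuple.
rewrite /flat_points /data_bit /data_point.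
elim: (tval S) p hp => //= q s IH [|p] hp.
  by rewrite nth_cat size_map size_tuple hi nth_encode.
by rewrite nth_cat size_map size_tuple mulSn -addnA ltnNge leq_addr /= addKn IH.
Qed.

Lemma hamming_dist (p q : cube d) : hamming p q = dist d (nth false p) (nth false q).
Proof.
rewrite /hamming /dist -sum1_card big_mkcond /=; apply: eq_bigr => i _.
by rewrite !inE !(tnth_nth false); case: ifP.
Qed.

Lemma qdistE (q : cube d) p : p < n ->
  qdist d flat_points (encode_point q) p = hamming (data_point p) q.
Proof.
move=> pn; rewrite hamming_dist.
apply: (@eq_psum _ (fun i => nth false (data_point p) i != nth false q i)) => i id_.
rewrite nth_encode nth_flat_points // /data_bit.
by case: (nth false q i); case: (nth false _ i).
Qed.

End Points.

Section Correct.
Variables (n d r1 r2 : nat) (S : n.-tuple (cube d)).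
Hypothesis n0 : 0 < n.
Hypothesis d0 : 0 < d.
Hypothesis r12 : r1 <= r2.
Notation A := (param_A n d r2).
Notation W := (param_W n d r2).
Notation E := (param_E n d r2).
Notation M := (param_M n d r2).
Notation L := (param_L n d r1 r2).
Notation cut := (param_cut n d r1 r2).
Notation pts := (flat_points S).
Notation coef v := (seed_coef n d r2 v).

Let W0 : 0 < W. Proof. by rewrite /param_W; case: ifP. Qed.

Definition seed_copy_good v (q : cube d) :=
  copy_good n d r2 L cut W pts (coef v) (encode_point q).

(** Coefficient [i] of table [m L + l] is digit [d (m L + l) + i] of the seed. Regrouped, digit [m]
    in base [(E ^ d) ^ L] is a copy, and its digit [l] in base [E ^ d] is a table. *)
Lemma hitsE v (q : cube d) m l p : l < L -> p < n ->
  hits d W pts (coef v) (encode_point q) (m * L + l) p =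
  hit_in d A W (data_bit S) (nth false q) (digit ((E ^ d) ^ L) v m) l p.
Proof.
move=> lL pn; rewrite /hits /hit_in /collide -/E digit_digit // [L * m]mulnC.
set t := m * L + l; have hi i : i < d -> coefs A W (digit (E ^ d) v t) i = coef v t i.
  by move=> id_; rewrite /coefs -/E digit_digit.
congr (_ %% _ == _ %% _); apply: eq_bigr => i _.
  by rewrite nth_flat_points // hi.
by rewrite nth_encode hi.
Qed.

Lemma fartherE (q : cube d) p : p < n ->
  farther d r2 pts (encode_point q) p = far d r2.+1 (data_bit S) (nth false q) p.
Proof. by move=> pn; rewrite /farther qdistE // hamming_dist. Qed.

Lemma seed_copy_goodE v (q : cube d) m : is_lsh n d r2 ->
  seed_copy_good v q m = good_copy n d r2.+1 (data_bit S) (nth false q) L (8 * L)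
    (hit_in d A W (data_bit S) (nth false q) (digit ((E ^ d) ^ L) v m)).
Proof.
move=> lsh; rewrite /seed_copy_good /copy_good /good_copy; congr (_ && _).
  apply: eq_existsb => l; apply: eq_existsb => p.
  by rewrite hitsE // fartherE.
rewrite /param_cut lsh; congr (_ < _).
apply: eq_bigr => l _; apply: eq_bigr => p _.
by rewrite hitsE // fartherE.
Qed.

Definition has_near (q : cube d) := [exists p : 'I_n, hamming (data_point S p) q <= r1].

Definition bad_seed v :=
  [exists q : cube d, has_near q && [forall m : 'I_M, ~~ seed_copy_good v q m]].

Lemma count_bad_seeds : is_lsh n d r2 ->
  n ^ 2 * \sum_(v < E ^ (M * L * d)) bad_seed v <= E ^ (M * L * d).
Proof.
move=> lsh; have [sA _ hA _] := lsh_A lsh d0; have hL := lsh_L r1 lsh d0.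
have A0 : 0 < A by apply: leq_trans sA.
set k := d + bitlen (n * n); have eM : M = 3 * k by rewrite /param_M lsh.
have eT : E ^ (M * L * d) = ((E ^ d) ^ L) ^ (3 * k).
  by rewrite -!expnM -eM; congr (_ ^ _); lia.
(* The factor [2 ^ d] pays for the union bound over all queries, and [n ^ 2] is the failure
   probability that remains. *)
have hk : 2 ^ d * n ^ 2 <= 2 ^ k.
  rewrite /k expnD leq_mul2l; apply/orP; right; rewrite -mulnn ltnW //.
  by have /andP[] : 2 ^ (bitlen (n * n)).-1 <= n * n < 2 ^ bitlen (n * n)
    by apply: trunc_log_bounds; rewrite ?muln_gt0 ?n0.
have d2 : 0 < 2 ^ d by rewrite expn_gt0.
rewrite -(leq_pmul2l d2) mulnA.
pose X (q : cube d) :=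
  \sum_(v < E ^ (M * L * d)) has_near q * \prod_(m < M) ~~ seed_copy_good v q m.
have hX : \sum_(v < E ^ (M * L * d)) bad_seed v <= \sum_(q : cube d) X q.
  rewrite exchange_big /=; apply: leq_sum => v _.
  case: (boolP (bad_seed v)) => // /existsP[q /andP[hq /forallP hm]].
  rewrite (bigD1 q) //= hq mul1n big1 // => m _; by rewrite hm.
apply: leq_trans (_ : 2 ^ k * \sum_(q : cube d) X q <= _); first exact: leq_mul.
rewrite big_distrr /=.
have <- : \sum_(q : cube d) E ^ (M * L * d) = 2 ^ d * E ^ (M * L * d).
  by rewrite sum_nat_const card_tuple card_bool.
apply: leq_sum => q _; rewrite /X.
case: (boolP (has_near q)) => hq; last first.
  by rewrite big1 ?muln0 // => v _; rewrite mul0n.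
have [p hp] := existsP hq; rewrite hamming_dist in hp.
have nW : n <= W by rewrite /param_W lsh.
have := @bad_seeds n d r2.+1 A W (data_bit S) (nth false q) W0 L r1 p k nW A0
  (param_L_gt0 n d r1 r2) hA hL r12 (ltn_ord p) hp.
rewrite -/E -eT; apply: leq_trans; rewrite leq_mul2l; apply/orP; right.
apply: leq_sum => v _; rewrite mul1n; move: (nat_of_ord v) => {}v.
rewrite eM; apply: eq_leq; apply: eq_bigr => m _.
by rewrite seed_copy_goodE.
Qed.

End Correct.

(** * Executions *)

Section Run.
Variables (n d r1 r2 : nat) (S : n.-tuple (cube d)).
Hypothesis n0 : 0 < n.
Hypothesis d0 : 0 < d.
Hypothesis r12 : r1 <= r2.
Hypothesis r2d : r2 <= d.
Notation A := (param_A n d r2).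
Notation W := (param_W n d r2).
Notation E := (param_E n d r2).
Notation M := (param_M n d r2).
Notation L := (param_L n d r1 r2).
Notation cut := (param_cut n d r1 r2).
Notation pts := (flat_points S).
Notation coef v := (seed_coef n d r2 v).
Notation inp0 := ([:: n; d; r1; r2] ++ pts).

Lemma no_bad_seed v : ~~ is_lsh n d r2 -> ~~ bad_seed r1 r2 S v.
Proof.
move=> nlsh; apply/existsPn => q; apply/negP => /andP[/existsP[p hp] /forallP hbad].
have eM : M = 1 by rewrite /param_M (negPf nlsh).
have eL : L = 1 by rewrite /param_L (negPf nlsh).
have M0 : 0 < M by rewrite eM.
have L0 : 0 < L by rewrite eL.
have hh t p' : hits d W pts (coef v) (encode_point q) t p'.
  by rewrite /hits /tab_hash /query_hash /param_W (negPf nlsh) !modn1.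
have far_p : ~~ farther d r2 pts (encode_point q) p.
  by rewrite /farther qdistE // -leqNgt (leq_trans hp).
have := hbad (Ordinal M0); rewrite /seed_copy_good /copy_good negb_and => /orP[/existsPn h|].
  by have /existsPn/(_ p) := h (Ordinal L0); rewrite hh far_p.
rewrite -leqNgt eL psumS psum0 add0n.
under eq_psum do rewrite hh andbT.
rewrite /param_cut (negPf nlsh); case: (leqP d r2) => hdr.
  have /eqP-> : psum (fun p => farther d r2 pts (encode_point q) p) n == 0.
    rewrite -leqn0 -(muln0 n); apply: psum_le => p' p'n; rewrite leqn0 eqb0.
    rewrite /farther qdistE // -leqNgt (leq_trans _ hdr) // /hamming.
    by rewrite -[X in _ <= X](card_ord d) max_card.
  by [].
(* Every point is a hit, but [p] is not far, so the far hits number fewer than [n]. *)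
rewrite /psum leqNgt; apply/negP/negPn.
apply: leq_trans (_ : \sum_(i < n) 1 <= _); last by rewrite sum_nat_const card_ord muln1.
rewrite (bigD1 p) //= [X in _ < X](bigD1 p) //= (negPf far_p) add0n ltnS.
by apply: leq_sum => i _; case: farther.
Qed.

Definition mem_len := image_len n d M L W.
(** The 8 comes from the budget [8 L], which a query multiplies by the number of a candidate. *)
Definition mem_bound := 8 * mem_len.
(** The base exceeds [E], because [A < 2 (r2 + 1) n] and [r2 < d] in the regime [is_lsh]. The
    exponent has [M L d] for the range of the seed and [d + 1] for the powers compared in the search
    for [A]. *)
Definition reg_bound := mem_bound + (4 * d * n) ^ (M * L * d + d + 1).
Notation Z := mem_len.
Notation Vm := mem_bound.
Notation V := reg_bound.

Lemma small_bounds :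
  [/\ [/\ n <= Z, d <= Z, r2 <= Z & r1 <= Z], [/\ M <= Z, L <= Z & W <= Z], 7 <= Z,
      [/\ n * d <= Z, d * W <= Z & M * L * d + d + 1 <= 2 * Z] & cut <= Vm /\ cut * n <= Vm].
Proof.
have /andP[W0 Wn] := param_W_bounds d r2 n0.
have M0 : 0 < M by exact: param_M_gt0.
have L0 : 0 < L by exact: param_L_gt0.
have eZ : Z = 7 + n * d + M * L * (d + n + W) by [].
have nd : n <= n * d by rewrite leq_pmulr.
have dn : d <= n * d by rewrite leq_pmull.
have dW : d * W <= n * d by rewrite mulnC leq_mul2r Wn orbT.
have LM : L <= M * L by rewrite leq_pmull.
have ML : M <= M * L by rewrite leq_pmulr.
have MLs : M * L <= M * L * (d + n + W) by rewrite leq_pmulr //; lia.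
have MLd : M * L * d <= M * L * (d + n + W) by rewrite leq_mul2l; apply/orP; right; lia.
have MLn : M * L * n <= M * L * (d + n + W) by rewrite leq_mul2l; apply/orP; right; lia.
have Ln : L * n <= M * L * n by rewrite leq_mul2r LM orbT.
have cn : cut * n <= 8 * (M * L * n) + n * d.
  rewrite /param_cut; case: ifP => [_|h]; first by rewrite -mulnA; lia.
  case: (leqP d r2) => hd; first by rewrite mul1n; lia.
  move: h; rewrite /is_lsh hd /= => /negbT; rewrite -leqNgt => h.
  by apply: leq_trans (_ : n * d <= _); [rewrite leq_mul2l h orbT | lia].
have cc : cut <= cut * n by rewrite leq_pmulr.
by rewrite /mem_bound; split; [split | split | | split | split]; lia.
Qed.

Lemma inp_bound : all (leq^~ V) inp0.
Proof.
have [[h1 h2 h3 h4] _ h5 _ _] := small_bounds.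
have ZV : Z <= V by rewrite /reg_bound /mem_bound; lia.
rewrite /= !(leq_trans _ ZV) //=; apply/allP => x hx.
by apply: leq_trans (allP (flat_points_le1 S) x hx) (leq_trans _ ZV); lia.
Qed.

Let u0 : 0 < 4 * d * n. Proof. by rewrite !muln_gt0 d0 n0. Qed.

Lemma pow_reg_bound b e : b <= 4 * d * n -> e <= M * L * d + d + 1 -> b ^ e <= V.
Proof.
move=> hb he; apply: leq_trans (leq_addl _ _); apply: leq_trans (leq_expl e hb) _.
by rewrite leq_pexp2l.
Qed.

Lemma E_bound : E < 4 * d * n.
Proof.
have nd : n <= d * n by rewrite leq_pmull.
rewrite /param_E /param_W /param_A; case: ifP => lsh; last by lia.
have [_ hA _ _] := lsh_A lsh d0; move: hA; rewrite /param_A lsh.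
have /andP[rd _] := lsh.
have : r2.+1 * n <= d * n by rewrite leq_mul2r rd orbT.
by lia.
Qed.

Lemma lsh_bounds : is_lsh n d r2 ->
  [/\ n * (2 * (r2.+1 * n) + n) ^ r2.+1 <= V, E.+1 ^ r1 <= V, d + bitlen (n * n) <= V,
      n * n <= V & 2 * (r2.+1 * n) + n <= V].
Proof.
move=> lsh; have nd : n <= d * n by rewrite leq_pmull.
have /andP[rd _] := lsh.
have rn : r2.+1 * n <= d * n by rewrite leq_mul2r rd orbT.
have [_ [h1 _ _] _ _ _] := small_bounds.
have hb : 2 * (r2.+1 * n) + n <= 4 * d * n by lia.
have hn : n <= 4 * d * n by lia.
split.
- apply: leq_trans (_ : (4 * d * n) ^ r2.+2 <= _); last by apply: pow_reg_bound; lia.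
  by rewrite [leqRHS]expnS; apply: leq_mul; [exact: hn | exact: leq_expl].
- by apply: pow_reg_bound; [exact: E_bound | lia].
- apply: leq_trans (_ : M <= _); first by rewrite /param_M lsh; lia.
  by rewrite /reg_bound /mem_bound; lia.
- by rewrite mulnn; apply: pow_reg_bound; lia.
- by rewrite -[leqLHS]expn1; apply: pow_reg_bound; lia.
Qed.

Lemma seed_bound : E.+1 ^ (M * L * d) <= V.
Proof. by apply: pow_reg_bound; [exact: E_bound | lia]. Qed.

Definition seed_image v := memory_image n d r2 M L cut W pts (coef v) (M * L).
Notation pre_runs := (runs num_regs V Vm Z inp0).
Notation seeds := (E ^ (M * L * d)).

Lemma E_gt0 : 0 < E.
Proof. by have /andP[W0 _] := param_W_bounds d r2 n0; rewrite /param_E addn_gt0 W0 orbT. Qed.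

Definition draw_config (a : seq nat) := Config [:: Rand 18 5; build] a [::] inp0.

(** The draw of the seed is the only step that [runs] does not cover; it separates two deterministic
    stretches. *)
Lemma preprocess_runs : exists k a,
  [/\ pre_runs k (start preprocess [::] inp0) (draw_config a), nth 0 a 5 = seeds &
      forall v, v < seeds -> exists k' a',
        pre_runs k' (step v (draw_config a)) (Config [::] a' (seed_image v) inp0)].
Proof.
have [[h1 h2 h3 h4] [h5 h6 h7] h8 [h9 h10 h11] [h12 h13]] := small_bounds.
have VmV : Vm <= V by exact: leq_addr.
have ZVm : Z <= Vm by rewrite /mem_bound; lia.
have ZV : Z <= V by exact: leq_trans VmV.
have okm0 : ok_mem Vm Z [::] by [].
have paramV : [/\ M <= V, L <= V, cut <= V & 8 <= V].
  by split; apply: leq_trans VmV => //; rewrite /mem_bound; lia.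
have ok0 : ok_regs num_regs V [::] by [].
pose drawn (a m : seq nat) := m = [::] /\
  exists a2 a3 a4 a6 a7 a21 a22 a23 a24 a25 a26 a27,
  a = params_regs n d r1 r2 a2 a3 a4 seeds a6 a7 0 0 (M * L) a21 a22 a23 a24 a25 a26 a27.
have [|k [a [m [_ hk [em ea]]]]] := @choose_params_tri n d r1 r2 pts V Vm
  (size_flat_points S) ZV VmV inp_bound (flat_points_le1 S) n0 d0 lsh_bounds seed_bound paramV
  0 drawn _ ok0 okm0 [:: Seq (Rand 18 5) build].
  by move=> *; split=> //; do 12 eexists.
subst m; have /and3P[oka _ _] := runs_ok2 hk; rewrite [regs _]/= in oka.
have okd : ok num_regs V Vm Z inp0 (draw_config a) by apply/and3P; split.
case: ea => a2 [a3 [a4 [a6 [a7 [a21 [a22 [a23 [a24 [a25 [a26 [a27 ea]]]]]]]]]]].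
exists (k + 1).+1, a; split; last 2 first.
- by rewrite ea.
- move=> v vs; have vV : v <= V.
    by apply: leq_trans seed_bound; apply: ltnW; apply: leq_trans vs _; apply: leq_expl.
  have -> : step v (draw_config a) = Config [:: build] (set_nth 0 a 18 v) [::] inp0 by [].
  have := @build_tri n d r1 r2 pts V Vm (size_flat_points S) ZV VmV inp_bound
    (flat_points_le1 S) n0 d0 lsh_bounds seed_bound paramV.
  have oka' : ok_regs num_regs V (set_nth 0 a 18 v) by exact: ok_regs_set.
  rewrite ea in oka' *; rewrite /params_regs [set_nth _ _ _ _]/= in oka' *.
  move=> /(_ _ _ _ _ v vV 0 a2 a3 a4 seeds a6 a7 0 a21 a22 a23 a24 a25 a26 a27
             (fun _ m => m = seed_image v)).
  have hVm : [/\ d <= Vm, r2 <= Vm, M <= Vm, L <= Vm & cut <= Vm].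
    by split=> //; apply: leq_trans ZVm.
  move=> /(_ hVm (leq_trans h1 ZVm) (leq_trans h7 ZVm) (leq_trans h10 ZV) (fun=> erefl)).
  move=> /(_ oka' okm0 [::]) [k' [a' [m' [_ hk' em']]]].
  by exists k', a'; rewrite -em'.
- apply: runs_step => //.
  rewrite /step /=; apply: runs_trans hk _; apply: runs_step => //.
  exact: runs0.
Qed.

(** Read off the preprocessing run, along which the bounds hold, rather than computed from the
    layout. *)
Lemma image_ok v : v < seeds -> ok_mem Vm Z (seed_image v).
Proof.
move=> vs; have [k [a [_ _ hbuild]]] := preprocess_runs.
by have [k' [a' hr]] := hbuild v vs; case/and3P: (runs_ok2 hr).
Qed.

Definition answer_ok v (q : cube d) (a : option (cube d)) :=
  (exists p, [/\ p < n, hamming (data_point S p) q <= r2 & a = Some (data_point S p)]) \/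
  (a = None /\ forall m, m < M -> ~~ seed_copy_good r1 r2 S v q m).

(** A query never holds the seed, so its registers obey [mem_bound] instead of [reg_bound]; this
    keeps the cost of a step logarithmic. *)
Lemma query_runs v (q : cube d) : ok_mem Vm Z (seed_image v) -> exists k a,
  [/\ k <= query_time d M L cut,
      runs num_regs Vm Vm Z (encode_point q) k (start query (seed_image v) (encode_point q))
           (Config [::] a (seed_image v) (encode_point q)) &
      answer_ok v q (answer d (Config [::] a (seed_image v) (encode_point q)))].
Proof.
move=> okm.
have [[h1 h2 h3 h4] [h5 h6 h7] h8 [h9 h10 h11] [h12 h13]] := small_bounds.
have ZVm : Z <= Vm by rewrite /mem_bound; lia.
have /andP[W0 Wn] := param_W_bounds d r2 n0.
have qV : all (leq^~ 1) (encode_point q).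
  by apply/allP => x /mapP[b _ ->]; exact: leq_b1.
have := @query_tri n d r2 M L cut W pts (coef v) Vm (encode_point q) (size_flat_points S)
  ZVm h13 h12 (leq_trans h10 ZVm) (param_M_gt0 n r2 d0) W0 d0.
move=> /(_ _ (flat_points_le1 S) qV) hq.
have ok0 : ok_regs num_regs Vm [::] by [].
have [k [a [m' [hk hr [em hpost]]]]] := hq (fun t i => seed_coef_lt d r2 v t i n0) ok0 okm [::].
subst m'; exists k, a; split=> //; case: hpost => [[p [pn fp ea]]|[ea hbad]]; [left|right].
  exists p; split=> //; first by rewrite -qdistE // leqNgt.
  rewrite /answer /reg [regs _]/= ea; congr Some; apply: eq_from_tnth => i.
  rewrite tnth_mktuple [Defs.mem _]/= /seed_image -addnA nth_image_pts ?size_flat_points //.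
    by rewrite nth_flat_points // (tnth_nth false) /data_bit; case: nth.
  apply: leq_trans (_ : p.+1 * d <= _); last by rewrite leq_mul2r pn orbT.
  by rewrite mulSn addnC ltn_add2r.
by split; [rewrite /answer /reg [regs _]/= ea | exact: hbad].
Qed.

Lemma session_correct v h m : ok_mem Vm Z (seed_image v) -> session query (seed_image v) h m ->
  m = seed_image v /\ forall q a, (q, a) \in h -> answer_ok v q a.
Proof.
move=> okm; elim=> {h m} // h m q t w s _ [-> IH] he.
have [k [a [_ hr hans]]] := query_runs q okm.
have [t' [w' [he' _]]] := exec_runs_inv hr he.
have [es _ _] := exec_halted_inv he' isT.
rewrite es; split=> // q' a'; rewrite mem_rcons inE => /orP[/eqP[-> ->] //|]; exact: IH.
Qed.

Definition space_needed := space_bound num_regs V Vm Z.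
Definition time_needed := query_time d M L cut * (2 * bitlen Vm).

Lemma query_resources v (q : cube d) : ok_mem Vm Z (seed_image v) ->
  exists t w s, [/\ exec (start query (seed_image v) (encode_point q)) t w s,
    t <= time_needed & w <= space_needed].
Proof.
move=> okm; have [k [a [hk hr _]]] := query_runs q okm.
have qV : all (leq^~ Vm) (encode_point q).
  apply/allP => x /mapP[b _ ->]; apply: leq_trans (leq_b1 b) _.
  by have [_ _ h8 _ _] := small_bounds; rewrite /mem_bound; lia.
set f := Config [::] a _ _ in hr.
have hf : exec f 0 (config_space f) f by apply: exec_halt.
have [t [w [he ht hw]]] := runs_cat_exec (leqnn _) qV hr hf.
exists t, w, f; split=> //.
  by apply: leq_trans ht _; rewrite addn0 leq_mul2r hk orbT.
apply: leq_trans hw _; rewrite (maxn_idPl _); last exact: ok_space (runs_ok2 hr).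
by rewrite leq_add2r leq_mul2l leq_bitlen // leq_addr.
Qed.

Lemma preprocess_resources t w s : exec (start preprocess [::] inp0) t w s ->
  w <= space_needed /\ exists v, [/\ Defs.mem s = seed_image v & ok_mem Vm Z (seed_image v)].
Proof.
move=> he; have [k [a [hr e5 hbuild]]] := preprocess_runs.
have [t1 [w1 [he1 hw1]]] := exec_runs_inv hr he.
have okd := runs_ok2 hr.
set s1 := draw_config a in he1; have hs1 : s1 = draw_config a by [].
case: he1 hs1 hw1 => {t1 w1} [s' hs' es|s' v t1 w1 s'' _ hv he1 es]; first by rewrite es in hs'.
move=> hw; rewrite es in hv he1 hw.
have vs : v < seeds.
  move: hv; rewrite /choices /= /reg /= e5; move: (expn_gt0 E (M * L * d)); rewrite E_gt0.
  by move: (E ^ _) => x /=; lia.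
have [k' [a' hr']] := hbuild v vs.
have [t2 [w2 [he2 hw2]]] := exec_runs_inv hr' he1.
have [es2 _ ew2] := exec_halted_inv he2 isT.
have okf := runs_ok2 hr'.
split; last by exists v; rewrite es2; split=> //; case/and3P: okf.
apply: leq_trans hw _; rewrite geq_max leqnn /= geq_max (ok_space okd) /=.
by apply: leq_trans hw2 _; rewrite geq_max leqnn ew2 (ok_space okf).
Qed.

Local Open Scope ring_scope.
Import GRing.Theory.

(** [prob] takes a single fuel, while the length of the path may depend on the seed drawn. *)
Lemma exists_uniform_bound (N : nat) (P : nat -> nat -> Prop) :
  (forall v, (v < N)%N -> exists k, P v k) ->
  (forall v k k', (k <= k')%N -> P v k -> P v k') ->
  exists K, forall v, (v < N)%N -> P v K.
Proof.
move=> h mono; elim: N h => [|N IH] h; first by exists 0%N.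
have [K hK] : exists K, forall v, (v < N)%N -> P v K by apply: IH => v vN; apply: h; apply: leqW.
have [k hk] := h N (ltnSn N).
exists (maxn K k) => v; rewrite ltnS leq_eqVlt => /orP[/eqP->|vN].
  exact: mono (leq_maxr _ _) hk.
exact: mono (leq_maxl _ _) (hK _ vN).
Qed.

(** The fuel is chosen before the event [G], since one fuel must serve all probabilities of the
    theorem. *)
Lemma preprocess_prob (R : realType) : exists fuel, forall G : seq nat -> Prop,
  prob R (fun s => G (Defs.mem s)) fuel (start preprocess [::] inp0) =
  seeds%:R^-1 * \sum_(v < seeds) (`[< G (seed_image v) >])%:R.
Proof.
have [k [a [hr e5 hbuild]]] := preprocess_runs.
pose P v K := forall G : seq nat -> Prop,
  prob R (fun s => G (Defs.mem s)) K (step v (draw_config a)) = (`[< G (seed_image v) >])%:R.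
have [|K hK] := @exists_uniform_bound seeds (fun v k => forall K, (k <= K)%N -> P v K) _
  (fun v k k' hk hv K hK => hv K (leq_trans hk hK)).
  move=> v /hbuild[k' [a' hr']]; exists k' => K hK G.
  by rewrite -(subnKC hK) (prob_runs _ _ _ hr') prob_halted.
exists (k + K.+1)%N => G; rewrite (prob_runs _ _ _ hr) /=.
have -> : choices (draw_config a) = seeds.
  by rewrite /choices /= /reg /= e5; apply/maxn_idPr; rewrite expn_gt0 E_gt0.
congr (_ * _); apply: eq_bigr => v _; exact: hK.
Qed.

End Run.

(** * Asymptotic bounds *)

Import Order.TTheory GRing.Theory Num.Theory.
Import numFieldNormedType.Exports.

Local Open Scope classical_set_scope.
Local Open Scope ring_scope.

Lemma copies_lsh n d r1 r2 : is_lsh n d r2 ->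
  (param_L n d r1 r2 + param_cut n d r1 r2 + 1 <= 10 * param_L n d r1 r2)%N.
Proof.
by move=> lsh; have := param_L_gt0 n d r1 r2; rewrite /param_cut lsh; lia.
Qed.

Lemma copies_brute n d r1 r2 : (0 < d)%N -> ~~ is_lsh n d r2 ->
  (1 + param_M n d r2 * (param_L n d r1 r2 + param_cut n d r1 r2 + 1) <= 3 + d)%N.
Proof.
move=> d0 lsh; rewrite /param_M /param_L /param_cut (negPf lsh).
case: (leqP d r2) => hd; first by lia.
by move: lsh; rewrite /is_lsh hd /= -leqNgt; lia.
Qed.

Section Bounds.
Variable R : realType.
Implicit Types x y : R.

Lemma ln2_ge : 2^-1 <= ln (2 : R).
Proof.
have : ln (1 + - 2^-1 : R) <= - 2^-1 by apply: le_ln1Dx; lra.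
have -> : 1 + - 2^-1 = 2^-1 :> R by lra.
by rewrite lnV ?posrE // lerN2.
Qed.

Lemma ln_le_sub1 x : 0 < x -> ln x <= x - 1.
Proof. by move=> x0; rewrite -{1}(subrKC 1 x); apply: le_ln1Dx; lra. Qed.

Lemma bitlen_le_ln k : (0 < k)%N -> (bitlen k)%:R <= 1 + 2 * ln (k%:R : R).
Proof.
move=> k0; rewrite /bitlen -natr1 addrC lerD2l.
have h : (2 ^ trunc_log 2 k <= k)%N by exact: trunc_logP.
have : ln ((2 ^ trunc_log 2 k)%:R : R) <= ln k%:R.
  by rewrite ler_ln ?posrE ?ltr0n ?expn_gt0 // ler_nat.
rewrite natrX lnXn // -[ln _ *+ _]mulr_natl => h2.
have : (trunc_log 2 k)%:R * 2^-1 <= (trunc_log 2 k)%:R * ln (2 : R).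
  by rewrite ler_wpM2l // ln2_ge.
by lra.
Qed.

Lemma bernoulli_le x m : 0 <= x <= 1 -> 1 - m%:R * x <= (1 - x) ^+ m.
Proof.
move=> /andP[x0 x1]; elim: m => [|m IH]; first by rewrite mul0r subr0 expr0.
rewrite exprSr; have h : (1 - m%:R * x) * (1 - x) <= (1 - x) ^+ m * (1 - x).
  by rewrite ler_wpM2r // subr_ge0.
apply: le_trans h; have := ler0n R m; rewrite -natr1; nra.
Qed.

Lemma bitlen_ub k : (k < 2 ^ bitlen k)%N.
Proof. by case: k => // k; have /andP[] := trunc_log_bounds (isT : 1 < 2)%N (ltn0Sn k). Qed.

Lemma bitlen_le_expn k e : (0 < e)%N -> (k < 2 ^ e)%N -> (bitlen k <= e)%N.
Proof.
case: k => [|k] e0 h; first by rewrite /bitlen trunc_log0.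
have /andP[lo _] := trunc_log_bounds (isT : 1 < 2)%N (ltn0Sn k).
by rewrite /bitlen -(@ltn_exp2l 2) //; exact: leq_ltn_trans h.
Qed.

Lemma bitlen_add_le a b : (bitlen (a + b) <= bitlen a + bitlen b)%N.
Proof.
apply: bitlen_le_expn => //; have ha := bitlen_ub a; have hb := bitlen_ub b.
have ha2 : (2 <= 2 ^ bitlen a)%N by rewrite -{1}[2%N]expn1 leq_exp2l.
have hb2 : (2 <= 2 ^ bitlen b)%N by rewrite -{1}[2%N]expn1 leq_exp2l.
rewrite expnD; move: (2 ^ bitlen a)%N (2 ^ bitlen b)%N ha hb ha2 hb2 => x y *; nia.
Qed.

Lemma bitlen_exp_le k e : (0 < e)%N -> (bitlen (k ^ e) <= e * bitlen k)%N.
Proof.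
move=> e0; apply: bitlen_le_expn; first by rewrite muln_gt0 e0.
by rewrite mulnC expnM ltn_exp2r // bitlen_ub.
Qed.

Variables (c : R) (n d r1 r2 : nat).
Hypothesis c1 : 1 < c.
Hypothesis n0 : (0 < n)%N.
Hypothesis d0 : (0 < d)%N.
Hypothesis r12 : (r1 <= r2)%N.
Hypothesis r2d : (r2 <= d)%N.
Hypothesis cr : is_lsh n d r2 -> c * r1%:R <= r2.+1%:R.
Notation A := (param_A n d r2).
Notation W := (param_W n d r2).
Notation E := (param_E n d r2).
Notation M := (param_M n d r2).
Notation L := (param_L n d r1 r2).
Notation cut := (param_cut n d r1 r2).
Notation Z := (mem_len n d r1 r2).
Notation Vm := (mem_bound n d r1 r2).

Let N : R := n%:R.
Let D : R := d%:R.
Let P : R := N `^ c^-1.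
Let l : R := 1 + ln (n * d)%:R.
(** [c / (c - 1)] is the price of rounding [A] to an integer, and 1 that of rounding [L] up. *)
Let C : R := 1 + c / (c - 1).

Let c0 : 0 < c. Proof. exact: lt_trans c1. Qed.
Let N1 : 1 <= N. Proof. by rewrite ler1n. Qed.
Let D1 : 1 <= D. Proof. by rewrite ler1n. Qed.
Let P1 : 1 <= P.
Proof. by rewrite -[1](powRr0 N); apply: ler_powR => //; rewrite invr_ge0 ltW. Qed.
Let PN : P <= N.
Proof.
rewrite -[leRHS]powRr1 ?(le_trans ler01) //; apply: ler_powR => //.
by rewrite invf_le1 // ltW.
Qed.
Let l1 : 1 <= l.
Proof. by rewrite lerDl ln_ge0 // ler1n muln_gt0 n0. Qed.
Let C1 : 1 <= C.
Proof. by rewrite lerDl divr_ge0 // ?subr_ge0 ltW. Qed.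

Lemma param_L_le : L%:R <= C * P.
Proof.
have hc1 := c1; have hc0 := c0; have hN1 := N1; have hP1 := P1; have hC1 := C1.
rewrite /param_L; case: ifP => [lsh|_]; last by rewrite -[leLHS]mulr1 ler_pM.
have [sA _ _ hA] := lsh_A lsh d0; have eE : E = (A + n)%N by rewrite /param_E /param_W lsh.
have A0 : (0 < A)%N by exact: leq_trans sA.
set a : R := A%:R; have a1 : 1 <= a by rewrite ler1n.
have hdiv : (E ^ r1 %/ A ^ r1)%N%:R <= ((a + N) / a) ^+ r1.
  rewrite expr_div_n ler_pdivlMr ?exprn_gt0 //; last by lra.
  by rewrite -natrX -natrM /a /N -natrD -natrX ler_nat eE leq_trunc_div.
(* [y] is the inverse rate at [A + 1], where maximality of [A] gives [y ^ s <= n]. Hence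
   [y ^ r1 <= n ^ (r1 / s) <= n ^ (1 / c)], and it remains to pass from [A + 1] to [A]. *)
set y := (a + 1 + N) / (a + 1).
have y1 : 1 <= y by rewrite /y ler_pdivlMr ?mul1r; lra.
have ys : y ^+ r2.+1 <= N.
  rewrite /y expr_div_n ler_pdivrMr ?exprn_gt0 //; last by lra.
  by rewrite /a /N !natr1 -natrD -!natrX -natrM ler_nat ltnW.
have yr : y ^+ r1 <= P.
  have y0 : 0 <= y by lra.
  have s0 : 0 < r2.+1%:R :> R by rewrite ltr0n.
  have -> : y ^+ r1 = (y ^+ r2.+1) `^ (r1%:R / r2.+1%:R).
    by rewrite -!powR_mulrn // -powRrM mulrCA mulfV ?mulr1 // gt_eqF.
  apply: le_trans (_ : N `^ (r1%:R / r2.+1%:R) <= _).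
    by apply: ge0_ler_powR; rewrite ?nnegrE ?divr_ge0 ?exprn_ge0 // ltW // (lt_le_trans _ N1).
  apply: ler_powR => //; rewrite ler_pdivrMr // ler_pdivlMl //; exact: cr.
(* With [x = 1 / (A + 1)] the left side is [(1 - x) ^ - r1]. Since [c r1 <= s <= A], also
   [r1 x <= 1 / c], and Bernoulli gives [1 / (1 - 1 / c)]. *)
have hq : ((a + 1) / a) ^+ r1 <= c / (c - 1).
  set x := (a + 1)^-1; have x01 : 0 <= x <= 1.
    by rewrite invr_ge0 invf_le1; lra.
  have ex : (a + 1) / a = (1 - x)^-1.
    by rewrite /x; field; apply/andP; split; apply/eqP; lra.
  have := bernoulli_le r1 x01.
  have hr : r1%:R * x <= c^-1.
    rewrite ler_pdivrMr; last by lra.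
    rewrite ler_pdivlMl //; apply: le_trans (cr lsh) _.
    by rewrite /a natr1 ler_nat ltnW.
  have -> : c / (c - 1) = (1 - c^-1)^-1 by field; apply/andP; split; apply/eqP; lra.
  move=> hb; rewrite ex exprVn lef_pV2 ?posrE; first by lra.
    by apply: exprn_gt0; rewrite subr_gt0 /x invf_lt1; lra.
  by rewrite subr_gt0 invf_lt1.
have hfin : ((a + N) / a) ^+ r1 <= c / (c - 1) * P.
  apply: le_trans (_ : ((a + 1) / a * y) ^+ r1 <= _); last first.
    by rewrite exprMn ler_pM ?exprn_ge0 ?divr_ge0 //; lra.
  have -> : (a + 1) / a * y = (a + 1 + N) / a.
    by rewrite /y; field; apply/andP; split; apply/eqP; lra.
  have a0 : 0 <= a^-1 by rewrite invr_ge0; lra.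
  by apply: lerXn2r; rewrite ?nnegrE ?mulr_ge0 //; lra.
by rewrite natrD /C mulrDl mul1r addrC lerD // (le_trans hdiv).
Qed.

Lemma param_M_le : M%:R <= 15 * (D * l).
Proof.
have hl1 := l1; have hD1 := D1; have hN1 := N1.
have Dl : D <= D * l by rewrite ler_peMr // (le_trans ler01).
have lDl : l <= D * l by rewrite ler_peMl // (le_trans ler01).
rewrite /param_M; case: ifP => _; last by lra.
have hb := @bitlen_le_ln (n * n) ltac:(by rewrite muln_gt0 n0).
have hln : ln (n * n)%:R <= 2 * ln (n * d)%:R :> R.
  have h0 : 0 < (n * d)%:R :> R by rewrite ltr0n muln_gt0 n0.
  have h1 : 0 < (n * n)%:R :> R by rewrite ltr0n muln_gt0 n0.
  rewrite mulr_natl -lnXn // ler_ln ?posrE ?exprn_gt0 // -natrX ler_nat -mulnn mulnACA.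
  by rewrite leq_pmulr // muln_gt0 d0.
have hl : l = 1 + ln (n * d)%:R by [].
rewrite natrM natrD -/D; lra.
Qed.

(** 45 is 15 from [param_M_le] times 3 from [d + 2 n <= 3 n]; 11 covers the header, the points and,
    outside the regime [is_lsh], the only table. *)
Let C2 : R := 11 + 45 * C.

Lemma mem_len_le : Z%:R <= C2 * (D * l * (N * P)).
Proof.
have hl1 := l1; have hD1 := D1; have hN1 := N1; have hP1 := P1; have hC1 := C1.
have hM := param_M_le; have hL := param_L_le.
have X1 : N * D <= D * l * (N * P).
  rewrite mulrC -mulrA ler_wpM2l ?(le_trans ler01) //.
  by rewrite mulrCA ler_peMr ?(le_trans ler01) // mulr_ege1.
have X0 : 1 <= N * D by rewrite mulr_ege1.
have ND1 : N <= N * D by rewrite ler_peMr // (le_trans ler01).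
have ND2 : D <= N * D by rewrite ler_peMl // (le_trans ler01).
rewrite /mem_len /image_len /prefix_len /stride !(natrD, natrM) -/N -/D.
rewrite /param_W; case: ifP => lsh; last first.
  have -> : M = 1%N by rewrite /param_M lsh.
  have -> : L = 1%N by rewrite /param_L lsh.
  move: (D * l * (N * P)) X1 => T X1.
  have CT : 0 <= C * T by rewrite mulr_ge0 ?(le_trans ler01) // (le_trans _ X1) // (le_trans _ X0).
  have -> : C2 * T = 11 * T + 45 * (C * T) by rewrite /C2; ring.
  by move: (C * T) CT => x CT; lra.
have dN : D <= N by rewrite ler_nat ltnW //; case/andP: lsh.
have hML : M%:R * L%:R * (D + N + n%:R) <= (15 * (D * l)) * (C * P) * (3 * N).
  apply: ler_pM; rewrite ?mulr_ge0 ?ler0n //; last by rewrite -/N; lra.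
  - by rewrite -/N; lra.
  - by apply: ler_pM; rewrite ?ler0n.
have e : 15 * (D * l) * (C * P) * (3 * N) = 45 * C * (D * l * (N * P)) by ring.
rewrite e in hML; rewrite /C2 mulrDl.
apply: lerD hML; move: (D * l * (N * P)) X1 => T X1; lra.
Qed.

Let C4 : R := 7 + 2 * ln (16 * C2).

Lemma bitlen_mem_bound_le : (bitlen Vm)%:R <= C4 * l.
Proof.
have hl1 := l1; have hD1 := D1; have hN1 := N1; have hP1 := P1; have hC1 := C1.
have hPN := PN; have hZ := mem_len_le.
have Z0 : (0 < Vm)%N by rewrite muln_gt0.
have hb := bitlen_le_ln Z0.
set x : R := (n * d)%:R; have ex : x = N * D by rewrite /x natrM.
have x1 : 1 <= x by rewrite ex mulr_ege1.
have hl : l = 1 + ln x by [].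
have lx : ln x <= x - 1 by apply: ln_le_sub1; lra.
have C20 : 1 <= C2 by rewrite /C2; lra.
have hV : Vm%:R <= 16 * C2 * x ^+ 3.
  rewrite natrM; apply: le_trans (_ : 8 * (C2 * (2 * x ^+ 3)) <= _); last by lra.
  rewrite ler_wpM2l //; apply: le_trans hZ _; rewrite ler_wpM2l //; first by lra.
  have -> : 2 * x ^+ 3 = D * (2 * x) * (N * x) by rewrite ex; ring.
  apply: ler_pM; rewrite ?mulr_ge0 //; try lra.
    by rewrite ler_wpM2l //; lra.
  apply: ler_wpM2l; first by lra.
  by apply: le_trans hPN _; rewrite ex ler_peMr //; lra.
have hln : ln Vm%:R <= ln (16 * C2) + 3 * ln x.
  have -> : 3 * ln x = ln (x ^+ 3) by rewrite lnXn ?mulr_natl //; lra.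
  rewrite -lnM ?posrE ?exprn_gt0 //; try lra.
  by rewrite ler_ln ?posrE ?ltr0n // mulr_gt0 ?exprn_gt0 //; lra.
have h16 : 0 <= ln (16 * C2) by apply: ln_ge0; lra.
have h3 : 0 <= ln (16 * C2) * ln x by rewrite mulr_ge0 // ln_ge0.
have h4 : 0 <= ln x by exact: ln_ge0.
rewrite hl /C4; move: (ln x) (ln (16 * C2)) (ln _) (bitlen _)%:R hln hb h3 h4 h16.
by move=> {hl lx hV hZ} u w a b *; lra.
Qed.

(** [448 = 32 * 14]: each of the 32 registers is allowed the length of a seed, [14 Z l] bits.
    [33 C4] pays for the memory cells and for the rest of the register bound. *)
Definition space_const := (33 * C4 + 448) * C2.

Lemma space_needed_le : (space_needed n d r1 r2)%:R <= space_const * l ^+ 2 * (D * (N * P)).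
Proof.
have hl1 := l1; have hb := bitlen_mem_bound_le; have hZ := mem_len_le.
have Z1 : (1 : R) <= Z%:R by rewrite ler1n.
have hx : (bitlen (4 * d * n))%:R <= 7 * l.
  have := @bitlen_le_ln (4 * d * n) ltac:(by rewrite !muln_gt0 d0 n0).
  have -> : (4 * d * n)%:R = 4 * (n * d)%:R :> R by rewrite -mulnA natrM [(d * n)%N]mulnC.
  rewrite lnM ?posrE ?ltr0n ?muln_gt0 ?n0 //.
  have h4 : ln (4 : R) <= 4 - 1 by exact: ln_le_sub1.
  have h5 : 0 <= ln (n * d)%:R :> R by rewrite ln_ge0 // ler1n muln_gt0 n0.
  by rewrite /l => h6; lra.
have hV : (bitlen (reg_bound n d r1 r2))%:R <= C4 * l + 2 * Z%:R * (7 * l).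
  apply: le_trans (_ : (bitlen Vm + (M * L * d + d + 1) * bitlen (4 * d * n))%N%:R <= _).
    rewrite ler_nat; apply: leq_trans (bitlen_add_le _ _) _; rewrite leq_add2l.
    by apply: bitlen_exp_le; rewrite addn1.
  rewrite natrD natrM lerD // ler_pM ?ler0n // -natrM ler_nat.
  by have [_ _ _ [_ _ h] _] := small_bounds n0 d0 r12 r2d.
rewrite /space_needed /space_bound natrD !natrM.
have C40 : 0 <= C4.
  have : 0 <= ln (16 * C2); last by rewrite /C4; lra.
  by apply: ln_ge0; have := C1; rewrite /C2; lra.
have h1 : Z%:R * (bitlen Vm)%:R <= Z%:R * (C4 * l) by rewrite ler_wpM2l // ler0n.
have h2 : C4 * l <= Z%:R * (C4 * l) by rewrite ler_peMl // mulr_ge0 //; lra.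
have -> : space_const * l ^+ 2 * (D * (N * P)) =
  (33 * C4 + 448) * l * (C2 * (D * l * (N * P))) by rewrite /space_const; ring.
apply: le_trans (_ : (33 * C4 + 448) * l * Z%:R <= _); last first.
  by rewrite ler_wpM2l // mulr_ge0 //; lra.
have -> : (33 * C4 + 448) * l * Z%:R = 33 * (Z%:R * (C4 * l)) + 32 * (2 * Z%:R * (7 * l)) by ring.
by move: (Z%:R * (C4 * l)) (2 * Z%:R * (7 * l)) h1 h2 hV => x y *; rewrite /num_regs; lra.
Qed.

(** [82 = 22 + 60] bounds a round per unit of [d]; [150 = 15 * 10] comes from the number of copies
    and the at most [10 L] rounds in each; [2 C4] is the cost of a step in units of [l]. *)
Definition time_const := 82 * (6 + 150 * C) * (2 * C4).

Lemma time_needed_le : (time_needed n d r1 r2)%:R <= time_const * l ^+ 2 * (D ^+ 2 * P).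
Proof.
have hl1 := l1; have hD1 := D1; have hN1 := N1; have hP1 := P1; have hC1 := C1.
have hM := param_M_le; have hL := param_L_le.
have hb := bitlen_mem_bound_le.
set T := D * l * P; have T1 : 1 <= T by rewrite !mulr_ege1.
have DT : D <= T.
  by rewrite -[leLHS]mulr1 /T -mulrA ler_wpM2l ?mulr_ege1 // (le_trans ler01).
have hcopies : (1 + M * (L + cut + 1))%N%:R <= (5 + 150 * C) * T.
  have CT : 0 <= C * T by rewrite mulr_ge0 //; lra.
  have -> : (5 + 150 * C) * T = 5 * T + 150 * (C * T) by ring.
  have [lsh|lsh] := boolP (is_lsh n d r2).
    apply: le_trans (_ : 1 + M%:R * (10 * L%:R) <= _).
      by rewrite natrD natrM lerD2l ler_wpM2l ?ler0n // -natrM ler_nat copies_lsh.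
    have : M%:R * (10 * L%:R) <= 15 * (D * l) * (10 * (C * P)).
      by rewrite ler_pM ?mulr_ge0 ?ler0n // ler_wpM2l.
    have -> : 15 * (D * l) * (10 * (C * P)) = 150 * (C * T) by rewrite /T; ring.
    by move: (C * T) CT => x *; lra.
  have := copies_brute r1 d0 lsh.
  rewrite -(ler_nat R) natrD -/D; move: (C * T) CT => x *; lra.
have e : time_const * l ^+ 2 * (D ^+ 2 * P) = 82 * (6 + 150 * C) * (D * T) * (2 * (C4 * l)).
  by rewrite /time_const /T; ring.
rewrite e /time_needed natrM [(2 * _)%:R]natrM; apply: ler_pM; rewrite ?mulr_ge0 ?ler0n //.
  rewrite /query_time natrD natrM.
  have h1 : (22 * d + 60)%:R <= 82 * D by rewrite natrD natrM -/D; lra.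
  apply: le_trans (_ : (5 + 150 * C) * T * (82 * D) + 82 * (D * T) <= _); last by lra.
  apply: lerD; first by apply: ler_pM; rewrite ?ler0n.
  have : 1 <= D * T by rewrite mulr_ege1.
  by lra.
by rewrite ler_wpM2l.
Qed.

End Bounds.

(** * From integer radii back to the ANN problem *)

Section Reduction.
Variables (R : realType) (c r : R) (n d : nat) (S : n.-tuple (cube d)).
Hypothesis r0 : 0 < r.

Lemma hamming_le (p q : cube d) : (hamming p q <= d)%N.
Proof. by rewrite /hamming -[leqRHS](card_ord d) max_card. Qed.

Lemma le_radius (x : R) (p q : cube d) : 0 <= x ->
  ((hamming p q)%:R <= x) = (hamming p q <= minn (Num.truncn x) d)%N.
Proof. by move=> x0; rewrite leq_min hamming_le andbT truncn_ge_nat. Qed.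

Lemma ball_inP (x : R) (q : cube d) : 0 <= x ->
  ball_in S q x <> finset.set0 -> has_near (minn (Num.truncn x) d) S q.
Proof.
move=> x0 /eqP/set0Pn[p]; rewrite inE => /andP[pS hp]; apply/existsP.
have iS : (index p S < n)%N by rewrite -[ltnRHS](size_tuple S) index_mem.
by exists (Ordinal iS); rewrite /data_point /= nth_index // -le_radius.
Qed.

Lemma point_in_ball (x : R) (q : cube d) p : 0 <= x -> (p < n)%N ->
  (hamming (data_point S p) q <= minn (Num.truncn x) d)%N -> data_point S p \in ball_in S q x.
Proof. by move=> x0 pn hp; rewrite inE mem_nth ?size_tuple //= le_radius. Qed.

Lemma answer_ok_correct v (q : cube d) a : 0 < c ->
  let r1 := minn (Num.truncn r) d in let r2 := minn (Num.truncn (c * r)) d in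
  ~~ bad_seed r1 r2 S v -> answer_ok r1 r2 S v q a -> ann_correct c r S q a.
Proof.
move=> c0 r1 r2 good ha.
have cr0 : 0 <= c * r by rewrite mulr_ge0 // ltW.
case: ha => [[p [pn hp ->]]|[-> hbad]].
  have hb := point_in_ball cr0 pn hp.
  split; first by exists (data_point S p).
    by move=> h0; rewrite h0 inE in hb.
  by right; exists (data_point S p).
split=> //; last by left.
move=> /(ball_inP (ltW r0)) hq; case/negP: good; apply/existsP; exists q.
by rewrite hq; apply/forallP => m; apply: hbad.
Qed.

End Reduction.

Theorem theorem16 (R : realType) (c : R) (hc : 1 < c) :
  exists (pre qry : cmd) (space time : nat -> nat -> nat) (eps : nat -> R),
    [/\ deterministic qry,
        eps @ \oo --> (0 : R),
        soft_O space (fun n d => d%:R * n%:R `^ (1 + c^-1 + eps n)),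
        soft_O time (fun n d => d%:R ^+ 2 * n%:R `^ (c^-1)) &
        forall (r : R) (n d : nat) (S : n.-tuple (cube d)),
          0 < r -> (0 < n)%N -> (0 < d)%N ->
          let s0 := start pre [::] (encode_instance c r S) in
          resources_within c r S pre qry (space n d) (time n d) /\
          exists fuel : nat,
            [/\ prob R (fun _ => True) fuel s0 = 1,
                prob R (answers_every_query c r S qry) fuel s0
                  >= 1 - (n%:R ^+ 2)^-1 &
                forall (adv : adversary d) (k : nat),
                  prob R (withstands c r S qry adv k) fuel s0
                    >= 1 - (n%:R ^+ 2)^-1]].
Proof.
have c0 : 0 < c by exact: lt_trans hc.
pose lg n d : R := 1 + ln (n * d)%:R.
pose fs (n d : nat) : R := space_const c * lg n d ^+ 2 * (d%:R * n%:R `^ (1 + c^-1 + 0)).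
pose ft (n d : nat) : R := time_const c * lg n d ^+ 2 * (d%:R ^+ 2 * n%:R `^ c^-1).
(* For [r2 < d] the truncation at [d] does not affect [c r], so [c r < r2 + 1]; together with
   [r1 <= r] this is the gap on which [param_L_le] relies. *)
have hinst r n d (S : n.-tuple (cube d)) : 0 < r -> (0 < n)%N -> (0 < d)%N ->
  let r1 := minn (Num.truncn r) d in let r2 := minn (Num.truncn (c * r)) d in
  [/\ (r1 <= r2)%N, (r2 <= d)%N & is_lsh n d r2 -> c * r1%:R <= r2.+1%:R].
  move=> r0 n0 d0 r1 r2; split; last 2 first.
  - exact: geq_minr.
  - move=> /andP[r2d _]; have e2 : r2 = Num.truncn (c * r).
      by apply/minn_idPl; move: r2d; rewrite /r2 gtn_min ltnn orbF => /ltnW.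
    apply: le_trans (_ : c * r <= _); last by rewrite e2 ltW // truncnS_gt.
    rewrite ler_pM2l //; apply: le_trans (_ : (Num.truncn r)%:R <= _).
      by rewrite ler_nat geq_minl.
    by rewrite truncn_le ltW.
  - by rewrite leq_min geq_minr andbT geq_min le_truncn // ler_peMl // ltW.
have pw n : (0 < n)%N -> n%:R `^ (1 + c^-1 + 0) = n%:R * n%:R `^ c^-1 :> R.
  by move=> n0; rewrite addr0 powRD ?powRr1 ?ler0n // pnatr_eq0 -lt0n n0 implybT.
have fs_ge r n d (S : n.-tuple (cube d)) : 0 < r -> (0 < n)%N -> (0 < d)%N ->
  (space_needed n d (minn (Num.truncn r) d) (minn (Num.truncn (c * r)) d))%:R <= fs n d.
  move=> r0 n0 d0; have [h1 h2 h3] := hinst r n d S r0 n0 d0.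
  by rewrite /fs pw //; exact: space_needed_le.
have ft_ge r n d (S : n.-tuple (cube d)) : 0 < r -> (0 < n)%N -> (0 < d)%N ->
  (time_needed n d (minn (Num.truncn r) d) (minn (Num.truncn (c * r)) d))%:R <= ft n d.
  move=> r0 n0 d0; have [h1 h2 h3] := hinst r n d S r0 n0 d0; exact: time_needed_le.
(* The bounds may depend on [n] and [d] only, so the real upper estimates are taken in place of the
   exact values, which vary with the radii. *)
exists preprocess, query, (fun n d => Num.truncn (fs n d)), (fun n d => Num.truncn (ft n d)).
(* Any dataset will do: it serves to deduce from [fs_ge] and [ft_ge] that the estimates are
   nonnegative. *)
have inst n d : exists S : n.-tuple (cube d), True.
  by exists [tuple of nseq n [tuple of nseq d false]].
exists (fun=> 0); split=> //; first exact: cvg_cst.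
- exists (space_const c), 2%N => n d n0 d0; have [S _] := inst n d.
  by rewrite truncn_le; apply: le_trans (fs_ge 1 n d S ltr01 n0 d0).
- exists (time_const c), 2%N => n d n0 d0; have [S _] := inst n d.
  by rewrite truncn_le; apply: le_trans (ft_ge 1 n d S ltr01 n0 d0).
move=> r n d S r0 n0 d0 s0.
have [r12 r2d _] := hinst r n d S r0 n0 d0.
set r1 := minn (Num.truncn r) d in r12; set r2 := minn (Num.truncn (c * r)) d in r12 r2d.
have hs : (space_needed n d r1 r2 <= Num.truncn (fs n d))%N.
  by rewrite truncn_ge_nat ?fs_ge //; apply: le_trans (fs_ge r n d S r0 n0 d0).
have ht : (time_needed n d r1 r2 <= Num.truncn (ft n d))%N.
  by rewrite truncn_ge_nat ?ft_ge //; apply: le_trans (ft_ge r n d S r0 n0 d0).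
split.
  move=> t w s he; have [hw [v [em okm]]] := preprocess_resources n0 d0 r12 r2d he.
  split; first exact: leq_trans hs.
  move=> h m q; rewrite em => hsess.
  have [-> _] := session_correct n0 d0 r12 r2d okm hsess.
  have [t' [w' [s' [he' ht' hw']]]] := query_resources n0 d0 r12 r2d q okm.
  by exists t', w', s'; split=> //; [exact: leq_trans ht | exact: leq_trans hs].
have [fuel hfuel] := preprocess_prob S n0 d0 r12 r2d R.
set T := (param_E n d r2 ^ (param_M n d r2 * param_L n d r1 r2 * d))%N in hfuel.
have T0 : 0 < T%:R :> R by rewrite ltr0n expn_gt0 E_gt0.
have good v : (v < T)%N -> ~~ bad_seed r1 r2 S v -> forall h m,
  session query (seed_image r1 r2 S v) h m ->
  all_correct c r S h.
  move=> vT gv h m hsess q a qa; apply: (answer_ok_correct r0 c0 gv).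
  by have [_] := session_correct n0 d0 r12 r2d (image_ok S n0 d0 r12 r2d vT) hsess; apply.
have hbad : (n ^ 2 * \sum_(v < T) bad_seed r1 r2 S v <= T)%N.
  have [lsh|lsh] := boolP (is_lsh n d r2); first exact: count_bad_seeds.
  by rewrite big1 ?muln0 // => v _; apply/eqP; rewrite eqb0; exact: no_bad_seed.
(* Both correctness events depend only on the final memory and hold for every seed that is not bad,
   so one estimate serves both. *)
have hprob (G : seq nat -> Prop) : (forall v, (v < T)%N -> ~~ bad_seed r1 r2 S v ->
    G (seed_image r1 r2 S v)) ->
  1 - (n%:R ^+ 2)^-1 <= prob R (fun s => G (Defs.mem s)) fuel s0.
  move=> hG; rewrite (hfuel G) mulrC ler_pdivlMr // mulrBl mul1r.
  apply: le_trans (_ : \sum_(v < T) (1 - (bad_seed r1 r2 S v)%:R) <= _).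
    rewrite sumrB sumr_const card_ord lerD2l lerN2 -natr_sum.
    have n2 : 0 < n%:R ^+ 2 :> R by rewrite exprn_gt0 // ltr0n.
    by rewrite ler_pdivlMl // -natrX -natrM ler_nat.
  apply: ler_sum => v _; case: (boolP (bad_seed _ _ _ _)) => [_|gv].
    by rewrite subrr ler0n.
  by rewrite subr0; case: asboolP => // -[]; apply: hG.
exists fuel; split.
- rewrite (hfuel (fun=> True)) (eq_bigr (fun=> 1)); last by move=> v _; rewrite asboolT.
  by rewrite sumr_const card_ord mulVf // gt_eqF.
- apply: (hprob (fun m => forall h m', session query m h m' -> all_correct c r S h)).
  exact: good.
- move=> adv k; apply: (hprob (fun m => forall h m', session query m h m' -> played_by adv h ->
    size h = k -> all_correct c r S h)) => v vT gv h m hsess _ _.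
  exact: good hsess.
Qed.
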